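(* Let $k\geq2$ be an integer and $\epsilon$ a positive real number. Suppose $\mu$ is a constant sum strong Rayleigh measure on $2^{[n]}$ such that $\mathbb{P}[S:i\in S]=\sum_{S\ni i}\mu(\{S\})\leq\epsilon$ for all $1\leq i\leq n$. Then there is a partition $S_1\cup\cdots\cup S_k=[n]$ such that $$\|\mathbf{e}_{S_i}\|=\lambda_{\max}(\mathbf{e}_{S_i})\leq\frac1k\,\delta(k\epsilon,n)$$ for each $1\leq i\leq k$, where $\delta(\alpha,n):=\Big(1-\frac1n+\sqrt{\alpha-\frac1n\big(1-\frac1n\big)}\Big)^2$.
   Context: A discrete probability measure $\mu$ on $2^{[n]}$ has multivariate partition function $P_\mu(\mathbf{x})=\sum_{S\subseteq[n]}\mu(\{S\})\prod_{j\in S}x_j$; $\mu$ is strong Rayleigh if $P_\mu(\mathbf{x})\neq0$ whenever $\operatorname{Im}(x_j)>0$ for all $j$, and of constant sum $d$ if $|S|=d$ whenever $\mu(\{S\})\neq0$. For a constant sum strong Rayleigh $\mu$, $P_\mu$ is a homogeneous polynomial hyperbolic with respect to the all-ones vector $\mathbf{1}$ (i.e. $P_\mu(\mathbf{1})\neq0$ and $t\mapsto P_\mu(t\mathbf{1}-\mathbf{x})$ is real-rooted for all real $\mathbf{x}$); eigenvalues $\lambda_1(\mathbf{x})\geq\cdots\geq\lambda_d(\mathbf{x})$ are defined by $P_\mu(t\mathbf{1}-\mathbf{x})=P_\mu(\mathbf{1})\prod_j(t-\lambda_j(\mathbf{x}))$, $\lambda_{\max}=\lambda_1$, $\|\mathbf{x}\|=\max_j|\lambda_j(\mathbf{x})|$.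 $\mathbf{e}_i$ is the $i$-th standard basis vector of $\mathbb{R}^n$ and $\mathbf{e}_S=\sum_{i\in S}\mathbf{e}_i$. *)

(* Defs.v *)
From HB Require Import structures.
From mathcomp Require Import all_boot all_order all_algebra.
From mathcomp Require Import reals.
From mathcomp Require Import complex.
Set Implicit Arguments. Unset Strict Implicit. Unset Printing Implicit Defensive.
Import Order.TTheory GRing.Theory Num.Theory.
Local Open Scope ring_scope.

Section Defs.
Variables (R : realType) (n : nat).

Definition prob_measure (mu : {ffun {set 'I_n} -> R}) : Prop :=
  (forall S, 0 <= mu S) /\ \sum_S mu S = 1.

Definition partition_fun (mu : {ffun {set 'I_n} -> R}) (x : 'I_n -> complex R)
  : complex R :=
  \sum_S (mu S)%:C%C * \prod_(j in S) x j.

Definition strong_Rayleigh (mu : {ffun {set 'I_n} -> R}) : Prop :=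
  forall x : 'I_n -> complex R,
    (forall j, 0 < complex.Im (x j)) -> partition_fun mu x != 0.

Definition constant_sum (mu : {ffun {set 'I_n} -> R}) (d : nat) : Prop :=
  forall S, mu S != 0 -> #|S| = d.

Definition Preal (mu : {ffun {set 'I_n} -> R}) (x : 'I_n -> R) : R :=
  \sum_S mu S * \prod_(j in S) x j.

Definition hyp_poly (mu : {ffun {set 'I_n} -> R}) (x : 'I_n -> R) : {poly R} :=
  \sum_S (mu S)%:P * \prod_(j in S) ('X - (x j)%:P).

(* lam = [:: lambda_1; ...; lambda_d] is the list of eigenvalues of x
   (w.r.t. P_mu and direction 1), in nonincreasing order:
   P_mu(t 1 - x) = P_mu(1) * prod_j (t - lambda_j). *)
Definition eigenvalues (mu : {ffun {set 'I_n} -> R}) (x : 'I_n -> R)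
  (lam : seq R) : Prop :=
  sorted (fun a b => b <= a) lam /\
  hyp_poly mu x = (Preal mu (fun _ => 1)) *: \prod_(l <- lam) ('X - l%:P).

(* lambda_max = lambda_1 (head of the sorted list; 0 if there are no eigenvalues). *)
Definition lambda_max_of (lam : seq R) : R := head 0 lam.

Definition hnorm_of (lam : seq R) : R := \big[Num.max/0]_(l <- lam) `|l|.

Definition e_set (S : {set 'I_n}) : 'I_n -> R := fun j => (j \in S)%:R.

End Defs.

Definition delta (R : realType) (alpha : R) (n : nat) : R :=
  (1 - n%:R^-1 + Num.sqrt (alpha - n%:R^-1 * (1 - n%:R^-1))) ^+ 2.

(* Main.v *)
Require Import Defs.
From HB Require Import structures.
From mathcomp Require Import all_boot all_order all_algebra.
From mathcomp Require Import reals.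
From mathcomp Require Import complex.
From mathcomp Require Import ring lra.
From mathcomp Require Import boolp.
Set Implicit Arguments.
Unset Strict Implicit.
Unset Printing Implicit Defensive.
Import Order.TTheory GRing.Theory Num.Theory.
Local Open Scope ring_scope.

(* Let H = P_mu^k and let y_1, ..., y_n be extra variables. The polynomial
   G(x, y) = prod_j (1 - y_j d/dx_j) H(x) is homogeneous and hyperbolic, and its
   hyperbolicity cone is obtained from the positive orthant by adding one condition
   y_j < xi_j(x, y) at a time, where xi_j = f / d_j f is concave because, on lines,
   d_j f / f is a sum of terms w / (s - rho) with w >= 0. A barrier argument puts the
   points with x = t 1 + b (1 - e_i) and y = 1 + (a - 1) e_i in this cone; averaging
   them over i and using homogeneity shows that G(T 1, 1) > 0 for T > delta(k eps, n).

   Now G(x, 1) is the average of prod_i P_mu(x - k e_{S_i}) over all ordered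
   partitions (S_1, ..., S_k): P_mu is affine in each variable, so that 1 - k d_j is a
   translation and 1 - sum_i d_(i,j) is the average of the operators 1 - k d_(i,j) acting
   on the i-th copy of the variables. The elements of [n] are assigned one by one: if
   f (1 - sum_i r_i) > 0 to the right of delta, where r_i = d_(i,j) f / f is
   decreasing, then some i satisfies f (1 - k r_i) > 0 there. *)

(** Why some y_i can exceed 1: after the last operator 1 - y_i d/dx_i only positivity has to
    survive, not a bound on the ratios d_j f / f. So coordinate i needs no shift by b, and y_i may
    be any a with a * kap < 1, where kap bounds these ratios. The gain sits in one coordinate;
    averaging over i spreads it, and this is what improves (1 + sqrt alpha)^2, the value reached
    with y = 1 and all coordinates shifted, to a constant with corrections in 1/n.

    Origin of delta: put alpha = k eps, c = 1 - 1/n and kap = 1 - 1/b. In the limit a = b / (b - 1)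
    and t = alpha b / (b - 1), the averaged point has the ratio b (alpha + c (b - 1)) / (b - c) of
    its x part to its y part. It is least at b = c + sqrt (alpha - c / n), where it equals b^2 =
    delta.

    These limiting values are not attained, so positivity is shown only for T > delta. That
    suffices: it excludes every eigenvalue whose k-fold exceeds delta.

    All limits are one-sided limits of polynomials, and all analytic facts on d_j f / f come from
    its partial fractions. *)

(** * Complex polynomials with roots in a half plane *)

Section ComplexFacts.
Variable R : rcfType.
Local Notation C := (complex R).
Local Notation toC := (real_complex R).
Local Notation Re := (@complex.Re R).
Local Notation Im := (@complex.Im R).

Lemma cImD (x y : C) : Im (x + y) = Im x + Im y.
Proof. by case: x y => [? ?] [? ?]. Qed.

Lemma cImN (x : C) : Im (- x) = - Im x.
Proof. by case: x. Qed.

Lemma cImM (x y : C) : Im (x * y) = Re x * Im y + Im x * Re y.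
Proof. by case: x y => [a b] [c d]. Qed.

Lemma cIm_sum (I : Type) (s : seq I) (P : pred I) (F : I -> C) :
  Im (\sum_(i <- s | P i) F i) = \sum_(i <- s | P i) Im (F i).
Proof. by elim/big_rec2: _ => //= i a b _ <-; rewrite cImD. Qed.

Lemma cIm_conj (x : C) : Im x^*%C = - Im x. Proof. by case: x. Qed.

Lemma cIm_inv (x : C) : Im x^-1 = - Im x / (Re x ^+ 2 + Im x ^+ 2).
Proof. by case: x => [a b] /=; rewrite mulNr. Qed.

Lemma ReIm2_gt0 (x : C) : x != 0 -> 0 < Re x ^+ 2 + Im x ^+ 2.
Proof.
case: x => a b; rewrite eq_complex /= negb_and => h.
rewrite lt_neqAle addr_ge0 ?sqr_ge0 // andbT eq_sym.
by rewrite paddr_eq0 ?sqr_ge0 // !sqrf_eq0 negb_and.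
Qed.

Lemma cIm_inv_le0 (x : C) : 0 <= Im x -> Im x^-1 <= 0.
Proof.
move=> h; rewrite cIm_inv mulNr oppr_le0 divr_ge0 //.
by rewrite addr_ge0 ?sqr_ge0.
Qed.

Lemma cIm_inv_lt0 (x : C) : 0 < Im x -> Im x^-1 < 0.
Proof.
move=> h; rewrite cIm_inv mulNr oppr_lt0 divr_gt0 // ReIm2_gt0 //.
by apply: contraTneq h => ->; rewrite ltxx.
Qed.

Lemma logderiv_prod (s : seq C) (t : C) : t \notin s ->
  (\prod_(z <- s) ('X - z%:P))^`().[t] =
  (\prod_(z <- s) ('X - z%:P)).[t] * \sum_(z <- s) (t - z)^-1.
Proof.
elim: s => [|z s IH]; first by rewrite !big_nil derivE horner0 mulr0.
rewrite inE negb_or => /andP[tz ts]; rewrite !big_cons derivM hornerD !hornerM.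
rewrite derivXsubC hornerC mul1r IH // hornerXsubC.
by rewrite mulrDr mulrAC mulfV ?subr_eq0 // mul1r mulrA.
Qed.

(** The logarithmic derivative is the sum of 1 / (t - z) over the roots z. For real t, each t - z
    lies in the closed upper half plane, so its inverse lies in the closed lower one, strictly if z
    is not real. *)
Lemma cIm_logderiv (p : {poly C}) (t : R) :
  (forall z, root p z -> Im z <= 0) -> ~~ root p t%:C%C ->
  Im (p^`().[t%:C%C] / p.[t%:C%C]) <= 0 /\
  ((exists2 z, root p z & Im z < 0) ->
    Im (p^`().[t%:C%C] / p.[t%:C%C]) < 0).
Proof.
move=> hroots ht; have [s ps] := closed_field_poly_normal p.
have p0 : lead_coef p != 0.
  by rewrite lead_coef_eq0; apply: contraNneq ht => ->; rewrite root0.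
have rootE z : root p z = (z \in s).
  by rewrite ps rootZ // root_prod_XsubC.
have -> : p^`().[t%:C%C] / p.[t%:C%C] = \sum_(z <- s) (t%:C%C - z)^-1.
  rewrite {1 2}ps derivZ !hornerZ logderiv_prod -?rootE //.
  have ev : (\prod_(z <- s) ('X - z%:P)).[t%:C%C] != 0.
    by rewrite -[_ == 0]/(root _ _) root_prod_XsubC -rootE.
  by field; rewrite ev p0.
rewrite cIm_sum; split.
  rewrite big_seq; apply: sumr_le0 => z zs.
  apply: cIm_inv_le0; rewrite cImD cImN /= add0r oppr_ge0; apply: hroots.
  by rewrite rootE.
case=> z; rewrite rootE => zs hz.
rewrite (big_rem z) //=.
apply: ltr_wnDr; last by apply: cIm_inv_lt0; rewrite cImD cImN /= add0r oppr_gt0.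
rewrite big_seq; apply: sumr_le0 => z' zs'.
apply: cIm_inv_le0; rewrite cImD cImN /= add0r oppr_ge0; apply: hroots.
by rewrite rootE (mem_rem zs').
Qed.

Lemma horner_conj (p : {poly R}) (s : C) :
  (map_poly toC p).[s^*%C] = ((map_poly toC p).[s])^*%C.
Proof.
elim/poly_ind: p => [|p c IH]; first by rewrite map_poly0 !horner0 conjc0.
rewrite !rmorphD !rmorphM /= map_polyX map_polyC !hornerE.
have e : (toC c)^*%C = toC c by exact: conjc_real.
by rewrite IH -[X in _ + X = _]e -rmorphM -rmorphD.
Qed.

Lemma horner_toC (p : {poly R}) (t : R) :
  (map_poly toC p).[t%:C%C] = (p.[t])%:C%C.
Proof. by rewrite horner_map. Qed.

Lemma complex_of_ImE0 (z : C) : Im z = 0 -> z = (Re z)%:C%C.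
Proof. by case: z => a b /= ->. Qed.

(** Non-real roots of a real polynomial come in conjugate pairs, so having none in the upper half
    plane leaves only real roots. *)
Lemma real_rooted_split (q : {poly R}) :
  (forall s : C, 0 < Im s -> (map_poly toC q).[s] != 0) ->
  exists rs : seq R, q = lead_coef q *: \prod_(a <- rs) ('X - a%:P).
Proof.
move=> hq; have [zs qs] := closed_field_poly_normal (map_poly toC q).
have [q0|q0] := eqVneq q 0.
  by exists [::]; rewrite q0 lead_coef0 scale0r.
have lq : lead_coef (map_poly toC q) = (lead_coef q)%:C%C.
  by rewrite lead_coef_map.
have lq0 : lead_coef (map_poly toC q) != 0.
  by rewrite lead_coef_eq0 map_poly_eq0.
exists [seq Re z | z <- zs].
apply: (map_poly_inj toC); rewrite [LHS]qs map_polyZ /= lq; congr (_ *: _).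
rewrite big_map rmorph_prod /= !big_seq; apply: eq_bigr => z zzs.
rewrite rmorphB /= map_polyX map_polyC; congr (_ - _%:P).
have rz : (map_poly toC q).[z] = 0.
  by apply/rootP; rewrite qs rootZ // root_prod_XsubC.
apply: complex_of_ImE0.
case: (ltgtP (Im z) 0) => // h.
- have := hq z^*%C; rewrite cIm_conj oppr_gt0 => /(_ h).
  by rewrite horner_conj rz conjc0 eqxx.
- by have := hq z h; rewrite rz eqxx.
Qed.

End ComplexFacts.

(** * Partial fractions with nonnegative residues *)

Section Nevanlinna.
Variable R : rcfType.
Local Notation C := (complex R).
Local Notation toC := (real_complex R).
Local Notation Re := (@complex.Re R).
Local Notation Im := (@complex.Im R).

(** That is, - r / q is a Nevanlinna (Herglotz) function without poles in the upper half plane. *)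
Definition nevanlinna (q r : {poly R}) := forall s : C, 0 < Im s ->
  (map_poly toC q).[s] != 0 /\
  Im ((map_poly toC r).[s] / (map_poly toC q).[s]) <= 0.

Lemma uniq_simple_roots (rs : seq R) :
  (forall a, a \in rs -> (\prod_(a <- rs) ('X - a%:P))^`().[a] != 0) -> uniq rs.
Proof.
elim: rs => //= a rs IH h; apply/andP; split.
  have := h a (mem_head _ _); rewrite big_cons derivM derivXsubC mul1r.
  rewrite hornerD hornerM hornerXsubC subrr mul0r addr0.
  by rewrite -[_ == 0]/(root _ _) root_prod_XsubC.
apply: IH => b brs; have := h b; rewrite inE brs orbT => /(_ isT).
rewrite big_cons derivM derivXsubC mul1r hornerD hornerM.
have /rootP -> : root (\prod_(j <- rs) ('X - j%:P)) b by rewrite root_prod_XsubC.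
by rewrite add0r mulf_eq0 negb_or => /andP[].
Qed.

(* If the real root [a] of [q] is not a root of [r], all roots of q + i r lie
   in the closed lower half plane and not all of them are real; the imaginary part of the
   logarithmic derivative of q + i r at [a] is -q'(a)/r(a). *)
Lemma nevanlinna_residue (q r : {poly R}) (a : R) :
  (size r < size q)%N -> nevanlinna q r ->
  (forall b, root q b -> r.[b] != 0) -> root q a ->
  0 < r.[a] / q^`().[a].
Proof.
move=> sz hqr cop qa.
set Q := map_poly toC q; set S := map_poly toC r.
pose h := Q + 'i%C *: S.
have szh : size h = size q.
  rewrite size_polyDl size_map_poly //.
  by apply: leq_ltn_trans (size_scale_leq _ _) _; rewrite size_map_poly.
have q0 : q != 0 by rewrite -size_poly_gt0; case: (size q) sz.
have hE z : h.[z] = Q.[z] + 'i%C * S.[z] by rewrite hornerD hornerZ.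
have noreal (b : R) : h.[b%:C%C] != 0.
  rewrite hE /Q /S !horner_toC; apply/negP => /eqP e.
  have : q.[b] = 0 /\ r.[b] = 0.
    by move: e => /eqP; rewrite eq_complex /=; simpc => /andP[/eqP -> /eqP ->].
  by case=> /rootP/cop/negP + e2; rewrite e2 eqxx.
(* At a root of [h] the quotient r / q equals i, whose imaginary part is positive; this cannot
   happen in the upper half plane. *)
have hroot z : root h z -> Im z <= 0.
  move=> /rootP; rewrite hE => e; rewrite leNgt; apply/negP => iz.
  have [Qz ImSQ] := hqr z iz.
  have Sz : S.[z] / Q.[z] = 'i%C.
    have -> : S.[z] = 'i%C * Q.[z].
      have -> : Q.[z] = - ('i%C * S.[z]) by apply/eqP; rewrite -addr_eq0 e.
      by rewrite mulrN mulrA -expr2 sqr_i mulN1r opprK.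
    by rewrite mulfK.
  by move: ImSQ; rewrite -/Q -/S Sz /= ler10.
have [_] := cIm_logderiv hroot (noreal a).
have -> : Im (h^`().[a%:C%C] / h.[a%:C%C]) = - (q^`().[a] / r.[a]).
  have ra := cop _ qa.
  rewrite hE /h derivD derivZ hornerD hornerZ /Q /S !deriv_map !horner_toC.
  move/rootP: qa => ->; rewrite add0r.
  move: (q^`().[a]) (r^`().[a]) (r.[a]) ra => u v w w0.
  rewrite cImM cIm_inv /=; field.
  by [].

have szh1 : (size h != 1)%N.
  rewrite szh; apply: contraL qa => /size_poly1P[c c0 ->].
  by rewrite rootC.
have ex : exists2 z, root h z & Im z < 0.
  have /closed_rootP[z hz] := szh1; exists z => //.
  rewrite lt_neqAle hroot // andbT; apply/negP => /eqP /complex_of_ImE0 e.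
  by move: (noreal (Re z)); rewrite -e (rootP hz) eqxx.
by move=> /(_ ex); rewrite oppr_lt0 => hh; rewrite -invr_gt0 invf_div.
Qed.

Lemma divp_XsubC_eval (q : {poly R}) (a s : R) : root q a ->
  (q %/ ('X - a%:P)).[s] * (s - a) = q.[s].
Proof.
by rewrite root_factor_theorem => /divpK {2}<-; rewrite hornerM hornerXsubC.
Qed.

Lemma divp_XsubC_deriv (q : {poly R}) (a : R) : root q a ->
  (q %/ ('X - a%:P)).[a] = q^`().[a].
Proof.
rewrite root_factor_theorem => /divpK {2}<-.
by rewrite derivM derivXsubC hornerD !hornerM hornerXsubC subrr mulr0 add0r hornerC mulr1.
Qed.

(** Without common roots all residues are positive and all roots of [q] are simple; the formula is
    then Lagrange interpolation of [r] at the roots of [q]. *)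
Lemma nevanlinna_lagrange (q r : {poly R}) :
  (size r < size q)%N -> nevanlinna q r ->
  (forall b, root q b -> r.[b] != 0) ->
  exists L : seq (R * R),
    (forall p, p \in L -> 0 <= p.1 /\ root q p.2) /\
    r = \sum_(p <- L) p.1 *: (q %/ ('X - (p.2)%:P)).
Proof.
move=> sz hqr cop.
have q0 : q != 0 by rewrite -size_poly_gt0; case: (size q) sz.
have [rs qs] : exists rs : seq R, q = lead_coef q *: \prod_(a <- rs) ('X - a%:P).
  by apply: real_rooted_split => s /hqr[].
have lq : lead_coef q != 0 by rewrite lead_coef_eq0.
have rootE a : root q a = (a \in rs) by rewrite qs rootZ // root_prod_XsubC.
have res a : a \in rs -> 0 < r.[a] / q^`().[a].
  by rewrite -rootE => ?; apply: nevanlinna_residue.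
(* If the derivative vanished, the quotient in [res] would be 0 by the convention on division,
   against its positivity. *)
have qd a : a \in rs -> q^`().[a] != 0.
  by move=> /res h; apply: contraTneq h => ->; rewrite invr0 mulr0 ltxx.
have urs : uniq rs.
  apply: uniq_simple_roots => a /qd; rewrite {1}qs derivZ hornerZ.
  by rewrite mulf_eq0 negb_or => /andP[].
have szq : size q = (size rs).+1 by rewrite qs size_scale // size_prod_XsubC.
exists [seq (r.[a] / q^`().[a], a) | a <- rs]; split.
  by move=> p /mapP[a ars ->] /=; rewrite rootE ars ltW // res.
rewrite big_map /=; apply/eqP; rewrite -subr_eq0; apply/eqP.
apply: (@roots_geq_poly_eq0 _ _ rs) => //; last first.
  rewrite (leq_trans (size_polyD _ _)) // geq_max -ltnS -szq sz size_polyN.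
  rewrite -ltnS -szq; have [->|ne] := eqVneq rs [::].
    by rewrite big_nil size_poly0 size_poly_gt0.
  apply: leq_ltn_trans (size_sum _ _ _) _; rewrite szq ltnS big_seq.
  elim/big_ind: _ => //= [x y hx hy|a ars]; first by rewrite geq_max hx.
  apply: leq_trans (size_scale_leq _ _) _.
  by rewrite size_divp ?polyXsubC_eq0 // size_XsubC szq /= subn1.
apply/allP => b brs; apply/rootP.
rewrite hornerD hornerN horner_sum (bigD1_seq b) //= hornerZ.
rewrite divp_XsubC_deriv ?rootE // divfK ?qd // big_seq_cond big1 ?addr0 ?subrr //.
move=> a /andP[ars ab]; rewrite hornerZ.
have := @divp_XsubC_eval q a b; rewrite rootE => /(_ ars).
rewrite (rootP (_ : root q b)) ?rootE // => /eqP.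
by rewrite mulf_eq0 subr_eq0 [b == a]eq_sym (negbTE ab) orbF => /eqP ->; rewrite mulr0.
Qed.

Lemma size_mulXsubC (p : {poly R}) (a : R) : p != 0 ->
  size (p * ('X - a%:P)) = (size p).+1.
Proof. by move=> p0; rewrite size_Mmonic ?monicXsubC // size_XsubC addn2. Qed.

(** A common root can be divided out of [q] and [r] without changing r / q, which gives an induction
    on the degree down to the coprime case. As an identity of polynomials, the result makes sense
    for multiple roots too. *)
Lemma nevanlinna_decomp (q r : {poly R}) :
  (size r < size q)%N -> nevanlinna q r ->
  exists L : seq (R * R),
    (forall p, p \in L -> 0 <= p.1 /\ root q p.2) /\
    r = \sum_(p <- L) p.1 *: (q %/ ('X - (p.2)%:P)).
Proof.
move: {2}(size q) (leqnn (size q)) => D; elim: D q r => [|D IH] q r szD sz hqr.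
  by move: sz szD; case: (size q).
have q0 : q != 0 by rewrite -size_poly_gt0; case: (size q) sz.
have [rs qs] : exists rs : seq R, q = lead_coef q *: \prod_(a <- rs) ('X - a%:P).
  by apply: real_rooted_split => s /hqr[].
have lq : lead_coef q != 0 by rewrite lead_coef_eq0.
have rootE a : root q a = (a \in rs) by rewrite qs rootZ // root_prod_XsubC.
have [/hasP[a ars /rootP ra]|/hasPn ncop] := boolP (has (root r) rs); last first.
  by apply: nevanlinna_lagrange => // b; rewrite rootE => /ncop.
have qa : ('X - a%:P) %| q by rewrite -root_factor_theorem rootE.
have da : ('X - a%:P) %| r by rewrite -root_factor_theorem; apply/rootP.
have qE := divpK qa; have rE := divpK da.
have X0 : 'X - a%:P != 0 by rewrite polyXsubC_eq0.
have q'0 : q %/ ('X - a%:P) != 0 by rewrite dvdp_div_eq0.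
have szq : size q = (size (q %/ ('X - a%:P))).+1.
  by rewrite -{1}qE size_mulXsubC.
have sz' : (size (r %/ ('X - a%:P))%R < size (q %/ ('X - a%:P))%R)%N.
  have [r0|r0] := eqVneq r 0; first by rewrite r0 div0p size_poly0 size_poly_gt0.
  by move: sz; rewrite -{1}rE -{1}qE !size_mulXsubC // dvdp_div_eq0.
have [L [hL eL]] : exists L : seq (R * R),
    (forall p, p \in L -> 0 <= p.1 /\ root (q %/ ('X - a%:P)) p.2) /\
    r %/ ('X - a%:P) = \sum_(p <- L) p.1 *: (q %/ ('X - a%:P) %/ ('X - (p.2)%:P)).
  apply: IH => //; first by rewrite -ltnS -szq.
  move=> s is0; have [h1 h2] := hqr s is0.
  have Cs : (map_poly toC ('X - a%:P)).[s] != 0.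
    rewrite rmorphB /= map_polyX map_polyC hornerXsubC subr_eq0.
    by apply: contraTneq is0 => ->; rewrite /= ltxx.
  move: h1 h2; rewrite -{1 2}qE -{1}rE !rmorphM !hornerM mulf_eq0 negb_or.
  by move=> /andP[h1 _]; rewrite -mulf_div divff // mulr1.
exists L; split.
  move=> p /hL[h1 h2]; split => //; rewrite -qE rootM h2 //.
rewrite -{1}rE eL mulr_suml; rewrite !big_seq; apply: eq_bigr => p /hL[_ h].
rewrite -scalerAl; congr (_ *: _).
by rewrite mulrC divp_mulA -?root_factor_theorem // [_ * (q %/ _)]mulrC qE.
Qed.

(** The total weight is read off at infinity: every quotient of [q] by a linear factor has degree D
    - 1 and the leading coefficient of [q]. *)
Lemma nevanlinna_coef (q r : {poly R}) (L : seq (R * R)) (D : nat) :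
  size q = D.+1 -> (forall p, p \in L -> 0 <= p.1 /\ root q p.2) ->
  r = \sum_(p <- L) p.1 *: (q %/ ('X - (p.2)%:P)) ->
  r`_D.-1 = q`_D * \sum_(p <- L) p.1.
Proof.
move=> szq hL ->; rewrite coef_sum mulr_sumr !big_seq; apply: eq_bigr => p /hL[_ rp].
rewrite coefZ mulrC; congr (_ * _).
have q0 : q != 0 by rewrite -size_poly_gt0 szq.
rewrite -[q in RHS](@divpK _ ('X - p.2%:P) q) -?root_factor_theorem //.
have e : size (q %/ ('X - (p.2)%:P)) = D.
  by rewrite size_divp ?polyXsubC_eq0 // size_XsubC szq subn1.
have D0 : (0 < D)%N.
  rewrite -e size_poly_gt0 dvdp_div_eq0 -?root_factor_theorem //.
rewrite mulrBr coefB coefMC coefMX -{2 4}(prednK D0) /= prednK //.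
by rewrite [X in X * _]nth_default ?e // mul0r subr0.
Qed.

Lemma nevanlinna_eval (q r : {poly R}) (L : seq (R * R)) (s : C) :
  (forall p, p \in L -> 0 <= p.1 /\ root q p.2) ->
  r = \sum_(p <- L) p.1 *: (q %/ ('X - (p.2)%:P)) ->
  (map_poly toC q).[s] != 0 ->
  (map_poly toC r).[s] / (map_poly toC q).[s] =
    \sum_(p <- L) (p.1)%:C%C / (s - (p.2)%:C%C).
Proof.
move=> hL -> qs; rewrite rmorph_sum /= horner_sum mulr_suml !big_seq.
apply: eq_bigr => p /hL[_ rp]; rewrite map_polyZ hornerZ /= -mulrA; congr (_ * _).
move: qs; rewrite -[q in X in X -> _](@divpK _ ('X - p.2%:P) q) -?root_factor_theorem //.
rewrite -[q in X in _ -> _ / X = _](@divpK _ ('X - p.2%:P) q) -?root_factor_theorem //.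
rewrite !rmorphM /= rmorphB /= map_polyX map_polyC !hornerM hornerXsubC /=.
by rewrite mulf_eq0 negb_or => /andP[h1 h2]; rewrite invfM mulrA mulfV // mul1r.
Qed.

Lemma nevanlinna_evalR (q r : {poly R}) (L : seq (R * R)) (s : R) :
  (forall p, p \in L -> 0 <= p.1 /\ root q p.2) ->
  r = \sum_(p <- L) p.1 *: (q %/ ('X - (p.2)%:P)) -> q.[s] != 0 ->
  r.[s] / q.[s] = \sum_(p <- L) p.1 / (s - p.2).
Proof.
move=> hL -> qs; rewrite horner_sum mulr_suml !big_seq.
apply: eq_bigr => p /hL[_ rp]; rewrite hornerZ -mulrA; congr (_ * _).
move: qs; rewrite -(divp_XsubC_eval s rp) mulf_eq0 negb_or => /andP[h1 h2].
by rewrite invfM mulrA mulfV // mul1r.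
Qed.

End Nevanlinna.

(** * Degree bounds with a prescribed top coefficient *)

Section Lead.
Variable K : comNzRingType.
Implicit Types (p q : {poly K}) (c : K).

(** The coefficient [c] may be 0, so that sums with cancelling leading terms are covered. *)
Definition lead_le (d : nat) p c := (size p <= d.+1)%N /\ p`_d = c.

Lemma lead_leM d e p q c c' :
  lead_le d p c -> lead_le e q c' -> lead_le (d + e)%N (p * q) (c * c').
Proof.
case=> sp ep [sq eq]; split.
  rewrite (leq_trans (size_polyMleq _ _)) //.
  by rewrite -subn1 leq_subLR add1n -addnS -addSn leq_add.
rewrite coefM (bigD1 (Ordinal (leq_addr e d : d < (d + e).+1)%N)) //=.
rewrite addKn ep eq big1 ?addr0 // => i /negbTE ne.
have {}ne : (i == d :> nat) = false by rewrite -ne.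
case: (ltngtP i d) ne => // h _.
  rewrite [q`__]nth_default ?mulr0 //; apply: leq_trans sq _.
  by rewrite ltn_subRL ltn_add2r.
by rewrite nth_default ?mul0r //; apply: leq_trans sp _.
Qed.

Lemma lead_leC c : lead_le 0%N c%:P c.
Proof. by split; rewrite ?size_polyC_leq1 // coefC. Qed.

Lemma lead_leL c c' : lead_le 1%N (c%:P + c' *: 'X) c'.
Proof.
split; last by rewrite coefD coefC coefZ coefX /= add0r mulr1.
rewrite (leq_trans (size_polyD _ _)) // geq_max.
rewrite (leq_trans (size_polyC_leq1 _)) //=.
by rewrite (leq_trans (size_scale_leq _ _)) // size_polyX.
Qed.

Lemma lead_leX d p c : lead_le 1%N p c -> lead_le d (p ^+ d) (c ^+ d).
Proof.
move=> h; elim: d => [|d IH]; first exact: lead_leC.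
by rewrite !exprS -add1n; apply: lead_leM.
Qed.

Lemma lead_leD d p q c c' : lead_le d p c -> lead_le d q c' -> lead_le d (p + q) (c + c').
Proof.
case=> sp ep [sq eq]; split; last by rewrite coefD ep eq.
by rewrite (leq_trans (size_polyD _ _)) // geq_max sp.
Qed.

Lemma lead_leN d p c : lead_le d p c -> lead_le d (- p) (- c).
Proof. by case=> sp ep; split; rewrite ?size_polyN // coefN ep. Qed.

Lemma lead_le0 d : lead_le d 0 0.
Proof. by split; rewrite ?size_poly0 ?coef0. Qed.

Lemma lead_leMn d p c e : lead_le d p c -> lead_le d (p *+ e) (c *+ e).
Proof.
move=> h; elim: e => [|e IH]; first exact: lead_le0.
by rewrite !mulrS; apply: lead_leD.
Qed.

End Lead.

(** * The operators 1 - y_j d/dx_j on polynomials *)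

Section Gam.
Variables (n : nat) (M : finType) (t : M -> 'I_n -> nat).

(* The image of x ^+ e under 1 - y d/dx. *)
Definition gamfac (K : comNzRingType) (e : nat) (x y : K) : K :=
  x ^+ e - y * x ^+ e.-1 *+ e.

(* The polynomial (prod_j (1 - y_j d/dx_j)) (sum_m w_m prod_j x_j ^ (t m j)). *)
Definition gam (K : comNzRingType) (w : M -> K) (x y : 'I_n -> K) : K :=
  \sum_m w m * \prod_j gamfac (t m j) (x j) (y j).

Definition upd (V : Type) (y : 'I_n -> V) (j : 'I_n) (c : V) : 'I_n -> V :=
  fun l => if l == j then c else y l.

(* The partial derivative of [gam w _ y] in the direction j, when y_j = 0. *)
Definition dgam (K : comNzRingType) (w : M -> K) (j : 'I_n) (x y : 'I_n -> K) : K :=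
  gam w x y - gam w x (upd y j 1).

Definition line (K : comNzRingType) (x v : 'I_n -> K) : 'I_n -> {poly K} :=
  fun j => (x j)%:P + v j *: 'X.

Lemma eq_gam (K : comNzRingType) (w w' : M -> K) (x x' y y' : 'I_n -> K) :
  w =1 w' -> x =1 x' -> y =1 y' -> gam w x y = gam w' x' y'.
Proof.
move=> hw hx hy; apply: eq_bigr => m _; rewrite hw; congr (_ * _).
by apply: eq_bigr => j _; rewrite hx hy.
Qed.

Lemma eq_dgam (K : comNzRingType) (w w' : M -> K) j (x x' y y' : 'I_n -> K) :
  w =1 w' -> x =1 x' -> y =1 y' -> dgam w j x y = dgam w' j x' y'.
Proof.
move=> hw hx hy; congr (_ - _); apply: eq_gam => // l.
by rewrite /upd hy.
Qed.

Lemma gam_morph (K L : comNzRingType) (f : {rmorphism K -> L}) (w : M -> K) x y :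
  f (gam w x y) = gam (f \o w) (f \o x) (f \o y).
Proof.
rewrite rmorph_sum; apply: eq_bigr => m _; rewrite rmorphM; congr (_ * _).
rewrite rmorph_prod; apply: eq_bigr => j _.
by rewrite /gamfac rmorphB rmorphMn rmorphM !rmorphXn.
Qed.

Lemma dgam_morph (K L : comNzRingType) (f : {rmorphism K -> L}) (w : M -> K) j x y :
  f (dgam w j x y) = dgam (f \o w) j (f \o x) (f \o y).
Proof.
rewrite rmorphB !gam_morph; congr (_ - _); apply: eq_gam => // l.
by rewrite /upd /=; case: eqP; rewrite ?rmorph1.
Qed.

(** [gamfac] is affine in y, so the values at y_j = 0 and y_j = 1 determine all others. *)
Lemma gam_upd (K : comNzRingType) (w : M -> K) j x y c : y j = 0 ->
  gam w x (upd y j c) = gam w x y - c * dgam w j x y.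
Proof.
move=> yj; rewrite /dgam mulrBr /gam !mulr_sumr -!sumrB; apply: eq_bigr => m _.
have D1 (F : 'I_n -> K) : \prod_i F i = F j * \prod_(i < n | i != j) F i.
  by rewrite (bigD1 j).
rewrite !D1 /upd eqxx yj.
set P := \prod_(i < n | i != j) gamfac _ _ (y i).
have e d : \prod_(i < n | i != j) gamfac (t m i) (x i) (if i == j then d else y i) = P.
  by apply: eq_bigr => i /negbTE ->.
rewrite (e c) (e 1).
rewrite /gamfac mul0r mul0rn mul1r -mulrnAr; ring.
Qed.

Lemma upd_id (V : Type) (y : 'I_n -> V) j : upd y j (y j) =1 y.
Proof. by move=> l; rewrite /upd; case: eqP => [->|]. Qed.

(** Each y_j has weight 1 and compensates the degree lost to d/dx_j. *)
Lemma gam_homog (K : comNzRingType) (w : M -> K) (D : nat) c x y :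
  (forall m, w m != 0 -> \sum_j t m j = D) ->
  gam w (fun j => c * x j) (fun j => c * y j) = c ^+ D * gam w x y.
Proof.
move=> hD; rewrite mulr_sumr; apply: eq_bigr => m _.
have [->|w0] := eqVneq (w m) 0; first by rewrite !mul0r mulr0.
rewrite mulrCA; congr (_ * _); rewrite -(hD m w0).
rewrite -prodrXr -big_split; apply: eq_bigr => j _ /=.
rewrite /gamfac; case: (t m j) => [|e]; first by rewrite !mulr0n !subr0 !expr0 mulr1.
rewrite /= mulrBr exprMn; congr (_ - _).
by rewrite exprMn mulrACA -exprS mulrnAr.
Qed.

Lemma gam_line_lead (K : comNzRingType) (w : M -> K) (D : nat) x v y u :
  (forall m, w m != 0 -> \sum_j t m j = D) ->
  (size (gam (polyC \o w) (line x v) (line y u)) <= D.+1)%N /\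
  (gam (polyC \o w) (line x v) (line y u))`_D = gam w v u.
Proof.
move=> hD.
rewrite -/(lead_le D _ _).
apply: (big_ind2 (lead_le D)) => [||m _]; [exact: lead_le0|by move=> *; apply: lead_leD|].
have [w0|w0] := eqVneq (w m) 0.
  by rewrite /= w0 polyC0 !mul0r; apply: lead_le0.
rewrite -[D]add0n; apply: lead_leM; first exact: lead_leC.
rewrite -(hD m w0).
apply: (big_rec3 (@lead_le K)) => [|j d p c _ h]; first exact: lead_leC.
apply: lead_leM => //; rewrite /gamfac; case: (t m j) => [|e].
  by rewrite !mulr0n !subr0 !expr0; apply: lead_leC.
apply: lead_leD; first by apply: lead_leX; apply: lead_leL.
by apply: lead_leN; apply: lead_leMn; rewrite -add1n; apply: lead_leM; [apply: lead_leL|apply: lead_leX; apply: lead_leL].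
Qed.

Lemma gam_line_eval (K : comNzRingType) (w : M -> K) x v y u s :
  (gam (polyC \o w) (line x v) (line y u)).[s] =
  gam w (fun j => x j + s * v j) (fun j => y j + s * u j).
Proof.
rewrite -[LHS]/(horner_eval s _) gam_morph.
by apply: eq_gam => j; rewrite /= /horner_eval ?hornerC // !hornerE mulrC.
Qed.

(** [dgam] is a difference of two polynomials of degree at most D on the line; since u_j = 0 their
    coefficients in degree D agree, which leaves degree D - 1. *)
Lemma dgam_line (K : comNzRingType) (w : M -> K) (D : nat) j x v y u :
  (forall m, w m != 0 -> \sum_j t m j = D) -> y j = 0 -> u j = 0 ->
  let r := dgam (polyC \o w) j (line x v) (line y u) in
  (size r <= D)%N /\ r`_D.-1 = dgam w j v u.
Proof.
move=> hD yj uj r.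
have e1 : upd (line y u) j 1 =1 line (upd y j 1) (upd u j 0).
  by move=> l; rewrite /upd /line; case: eqP; rewrite // scale0r addr0.
have rE : r = gam (polyC \o w) (line x v) (line y u) -
              gam (polyC \o w) (line x v) (line (upd y j 1) (upd u j 0)).
  by congr (_ - _); apply: eq_gam.
have [s1 c1] := gam_line_lead x v y u hD.
have [s2 c2] := gam_line_lead x v (upd y j 1) (upd u j 0) hD.
have szr : (size r <= D)%N.
  have szr : (size r <= D.+1)%N.
    by rewrite rE (leq_trans (size_polyD _ _)) // geq_max s1 size_polyN.
  apply/leq_sizeP => i; rewrite leq_eqVlt => /predU1P[<-|h]; last first.
    by move/leq_sizeP: szr; apply.
  rewrite rE coefB c1 c2; apply/eqP; rewrite subr_eq0; apply/eqP.
  by apply: eq_gam => // l; rewrite -{1}uj upd_id.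
split=> //.
(* To find the coefficient in degree D - 1, let y_j run along the line as 'X. This subtracts 'X *
   [r], and the coefficients in degree D are known before and after. *)
have [_ c3] := gam_line_lead x v (upd y j 0) (upd u j 1) hD.
have e3 : gam (polyC \o w) (line x v) (line (upd y j 0) (upd u j 1)) =
   gam (polyC \o w) (line x v) (line y u) - 'X * r.
  rewrite -gam_upd; last by rewrite /line yj uj scale0r addr0.
  apply: eq_gam => // l; rewrite /upd /line; case: eqP => // _.
  by rewrite scale1r add0r.
have : ('X * r)`_D = dgam w j v u.
  rewrite /dgam -c1 -c3 e3 coefB; ring.
rewrite coefXM; case: D szr {hD s1 c1 s2 c2 c3} => [|D] //=.
by rewrite leqn0 size_poly_eq0 => /eqP -> <-; rewrite coef0.
Qed.

(** When y_j = 0 the j-th factor is x ^+ e, and its derivative is the drop of [gamfac] from y_j = 0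
    to y_j = 1. *)
Lemma deriv_gam (K : comNzRingType) (w : M -> K) j x y : y j = 0 ->
  (gam (polyC \o w) (line x (fun l => (l == j)%:R)) (polyC \o y))^`() =
  dgam (polyC \o w) j (line x (fun l => (l == j)%:R)) (polyC \o y).
Proof.
move=> yj; rewrite /dgam /gam -sumrB raddf_sum; apply: eq_bigr => m _ /=.
rewrite derivM derivC mul0r add0r -mulrBr; congr (_ * _).
have D1 (F : 'I_n -> {poly K}) : \prod_i F i = F j * \prod_(i < n | i != j) F i.
  by rewrite (bigD1 j).
rewrite !D1 derivM.
set P := \prod_(i < n | i != j) gamfac _ _ ((polyC \o y) i).
have -> : \prod_(i < n | i != j) gamfac (t m i) (line x (fun l => (l == j)%:R) i)
    (upd (polyC \o y) j 1 i) = P.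
  by apply: eq_bigr => i /negbTE; rewrite /upd => ->.
have -> : P^`() = 0.
  rewrite /P; elim/big_rec: _ => [|i p ij e]; first by rewrite derivC.
  rewrite derivM e mulr0 addr0 /line (negbTE ij) scale0r addr0.
  rewrite /gamfac -!polyC_exp -polyCM -polyCMn -polyCB derivC mul0r //.
rewrite mulr0 addr0 -mulrBl; congr (_ * _).
rewrite /upd eqxx yj /gamfac /line eqxx scale1r !mul0r mul0rn !subr0.
by rewrite deriv_exp derivD derivC derivX add0r !mul1r subKr.
Qed.

End Gam.

(** * One-sided limits of polynomials at 0 *)

Section PolyLimits.
Variable R : rcfType.

Lemma poly_pos_near0 (p : {poly R}) : 0 < p.[0] ->
  exists2 e, 0 < e & forall x, 0 <= x <= e -> 0 < p.[x].
Proof.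
elim/poly_ind: p => [|p c _]; first by rewrite horner0 ltxx.
rewrite !hornerE => c0.
pose B := \sum_(i < size p) `|p`_i|.
have B0 : 0 <= B by apply: sumr_ge0.
have hB x : 0 <= x <= 1 -> `|p.[x]| <= B.
  move=> /andP[x0 x1]; rewrite horner_coef; apply: le_trans (ler_norm_sum _ _ _) _.
  apply: ler_sum => i _; rewrite normrM ler_piMr // ger0_norm ?exprn_ge0 //.
  exact: exprn_ile1.
pose e := Num.min 1 (c / (B + 1)).
have h1 : 0 < c / (B + 1) by rewrite divr_gt0 // ltr_wpDl.
exists e; first by rewrite lt_min ltr01.
move=> x /andP[x0]; rewrite le_min => /andP[x1 xe]; rewrite !hornerE.
have : - (p.[x] * x) < c; last by move=> h; rewrite -ltrBlDl sub0r.
apply: le_lt_trans (ler_norm _) _; rewrite normrN normrM (ger0_norm x0).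
have [->|xn0] := eqVneq x 0; first by rewrite mulr0.
have xp : 0 < x by rewrite lt_neqAle eq_sym xn0.
apply: (@le_lt_trans _ _ (B * x)).
  by apply: ler_wpM2r => //; apply: hB; rewrite x0.
move: xe; rewrite ler_pdivlMr ?ltr_wpDl //; apply: lt_le_trans.
by rewrite mulrC ltr_pM2l // ltrDl.
Qed.

Lemma poly_ge0_near0 (p : {poly R}) (e : R) : 0 < e ->
  (forall x, 0 < x <= e -> 0 <= p.[x]) -> 0 <= p.[0].
Proof.
move=> e0 h; rewrite leNgt; apply/negP => p0.
have /poly_pos_near0[d d0 hd] : 0 < (- p).[0] by rewrite hornerN oppr_gt0.
pose x := Num.min d e.
have x0 : 0 < x by rewrite lt_min d0.
have := hd x; rewrite (ltW x0) ge_min lexx /= => /(_ isT).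
rewrite hornerN oppr_gt0 ltNge h // x0 ge_min lexx orbT //.
Qed.

(** Write p = X p1: then p1 is nonnegative to the right of 0, and p1(0) is the derivative of p at
    0. *)
Lemma poly_deriv_ge0_near0 (p : {poly R}) (e : R) : 0 < e -> p.[0] = 0 ->
  (forall x, 0 < x <= e -> 0 <= p.[x]) -> 0 <= p^`().[0].
Proof.
elim/poly_ind: p => [|p c _] e0; first by rewrite derivC horner0.
rewrite !hornerE => -> h; rewrite addr0 derivM derivX !hornerE.
apply: (poly_ge0_near0 e0) => x /andP[x0 xe].
have := h x; rewrite x0 xe => /(_ isT); rewrite !hornerE.
by rewrite pmulr_lge0.
Qed.

End PolyLimits.

(** * Two inequalities for sums of w / (s - rho) *)

Section ParallelSum.
Variable R : rcfType.
Local Notation C := (complex R).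

(** Each term w / (1 - rho) is the parallel sum A B / (A + B) of A = w / (0 - rho) and B = w, and
    the parallel sum is superadditive. This becomes the concavity of f / d_j f, multiplied out so
    that zero values are allowed. *)
Lemma parallel_sum (L : seq (R * R)) :
  (forall p, p \in L -> 0 <= p.1 /\ p.2 < 0) ->
  \sum_(p <- L) p.1 / (1 - p.2) <= \sum_(p <- L) p.1 /\
  (\sum_(p <- L) p.1 / (1 - p.2)) *
    (\sum_(p <- L) p.1 / (0 - p.2) + \sum_(p <- L) p.1) <=
  (\sum_(p <- L) p.1 / (0 - p.2)) * \sum_(p <- L) p.1.
Proof.
move=> hL; split.
  rewrite !big_seq; apply: ler_sum => p /hL[h1 h2].
  by rewrite ler_piMr // invf_le1; lra.
move: hL.
move=> hL; set S1 := \sum_(p <- L) _; set S0 := \sum_(p <- L) p.1 / (0 - p.2).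
set W := \sum_(p <- L) p.1.
have S00 : 0 <= S0.
  rewrite /S0 big_seq; apply: sumr_ge0 => p /hL[h1 h2]; rewrite divr_ge0 //; lra.
have W0 : 0 <= W by rewrite /W big_seq; apply: sumr_ge0 => p /hL[].
(* The variational form of the parallel sum, proved termwise by a perfect square; its optimum a =
   [S0], b = [W] is used below. *)
have key a b : S1 * (a + b) ^+ 2 <= a ^+ 2 * W + b ^+ 2 * S0.
  rewrite /S1 /W /S0 mulr_suml !mulr_sumr -big_split /=.
  rewrite !big_seq; apply: ler_sum => p /hL[h1 h2].
  rewrite -subr_ge0.
  have -> : a ^+ 2 * p.1 + b ^+ 2 * (p.1 / (0 - p.2)) -
     p.1 / (1 - p.2) * (a + b) ^+ 2 =
     (p.1 / ((1 - p.2) * (0 - p.2))) * (a * p.2 + b) ^+ 2.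
    by field; apply/andP; split; apply/eqP; lra.
  rewrite mulr_ge0 ?sqr_ge0 // divr_ge0 // mulr_ge0 //; lra.
have [e|ne] := eqVneq (S0 + W) 0.
  by rewrite e mulr0 mulr_ge0.
have pos : 0 < S0 + W by rewrite lt_neqAle eq_sym ne addr_ge0.
rewrite -(ler_pM2r pos) -mulrA -expr2; apply: le_trans (key S0 W) _.
by rewrite le_eqVlt; apply/orP; left; apply/eqP; ring.
Qed.

(** With the sum written as - B - i A, a product equal to 1 means u A = 1 + y B and y A = - u B.
    These force u > 0, and the form [quad] at (y, u) then yields u W >= 1. *)
Lemma tube_parallel_sum (L : seq (R * R)) (y u : R) :
  (forall p, p \in L -> 0 <= p.1) -> u * (\sum_(p <- L) p.1) < 1 ->
  Complex y u * (\sum_(p <- L) (p.1)%:C%C / ('i%C - (p.2)%:C%C)) != 1.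
Proof.
move=> hL; set W := \sum_(p <- L) _ => hW; apply/negP => /eqP e.
pose A := \sum_(p <- L) p.1 / (p.2 ^+ 2 + 1).
pose B := \sum_(p <- L) p.1 * p.2 / (p.2 ^+ 2 + 1).
have sq (a : R) : 0 < a ^+ 2 + 1 by rewrite ltr_wpDl // sqr_ge0.
have sumE : \sum_(p <- L) (p.1)%:C%C / ('i%C - (p.2)%:C%C) = Complex (- B) (- A).
  rewrite /A /B; elim: (L) => [|p L' IH]; first by rewrite !big_nil oppr0.
  rewrite !big_cons IH; apply/eqP; rewrite eq_complex /=.
  rewrite !(sub0r, subr0, oppr0, mul0r, addr0, add0r, expr1n, sqrrN, subr0).
  apply/andP; split; apply/eqP; rewrite opprD; congr (_ + _).
  - by rewrite mulrA mulrN mulNr.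
  - by rewrite mulrN mul1r.
have WE : W = A + \sum_(p <- L) p.1 * p.2 ^+ 2 / (p.2 ^+ 2 + 1).
  rewrite /W /A -big_split /=; apply: eq_bigr => p _.
  by field; rewrite gt_eqF // sq.
set E := \sum_(p <- L) _ in WE.
have quad (a b : R) : 0 <= A * a ^+ 2 + 2%:R * a * b * B + b ^+ 2 * E.
  rewrite /A /B /E mulr_suml !mulr_sumr -!big_split /= big_seq.
  apply: sumr_ge0 => p /hL p0.
  have -> : p.1 / (p.2 ^+ 2 + 1) * a ^+ 2 + 2%:R * a * b * (p.1 * p.2 / (p.2 ^+ 2 + 1)) +
    b ^+ 2 * (p.1 * p.2 ^+ 2 / (p.2 ^+ 2 + 1)) = p.1 / (p.2 ^+ 2 + 1) * (a + b * p.2) ^+ 2.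
    by field; rewrite gt_eqF // sq.
  by rewrite mulr_ge0 ?sqr_ge0 // divr_ge0 // ltW // sq.
have A0 : 0 <= A.
  rewrite /A big_seq; apply: sumr_ge0 => p /hL p0.
  by rewrite divr_ge0 // ltW // sq.
move: e; rewrite sumE => /eqP; rewrite eq_complex /= => /andP[/eqP e1 /eqP e2].
have e1' : u * A = 1 + y * B by lra.
have e2' : y * A = - (u * B) by lra.
have ue : u = (u ^+ 2 + y ^+ 2) * A.
  have -> : (u ^+ 2 + y ^+ 2) * A = u * (u * A) + y * (y * A) by ring.
  by rewrite e1' e2'; ring.
have u0 : 0 < u.
  rewrite lt_neqAle eq_sym andbC {1}ue mulr_ge0 ?addr_ge0 ?sqr_ge0 //=.
  apply/eqP => uz; rewrite uz mul0r in e1' e2'.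
  have [Az|An] := eqVneq A 0; last first.
    have yz : y = 0 by move: e2' => /eqP; rewrite ?mul0r ?oppr0 mulf_eq0 (negbTE An) orbF => /eqP.
    by move: e1' => /eqP; rewrite yz mul0r addr0 eq_sym oner_eq0.
  (* Here A = 0 while y B = -1. The form is then affine in its first argument, and y (E + 1) is
     large enough to make it negative. *)
  have E0 := quad 0 1; have := quad (y * (E + 1)) 1.
  have yB : y * B = -1 by lra.
  have -> : A * (y * (E + 1)) ^+ 2 + 2 * (y * (E + 1)) * 1 * B + 1 ^+ 2 * E =
    A * (y * (E + 1)) ^+ 2 + 2 * (E + 1) * (y * B) + E by ring.
  by rewrite yB Az; lra.
move: hW; rewrite WE ltNge => /negP; apply.
rewrite mulrDr e1'.
have : 0 <= u * (u * E + y * B).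
  have := quad y u.
  have -> : A * y ^+ 2 + 2 * y * u * B + u ^+ 2 * E =
     y * (y * A) + 2 * y * u * B + u ^+ 2 * E by ring.
  by rewrite e2'; lra.
rewrite pmulr_rge0 //; lra.
Qed.

End ParallelSum.

(** * The hyperbolicity cone and its tube domain *)

Section Cone.
Variables (R : rcfType) (n : nat) (M : finType) (t : M -> 'I_n -> nat).
Variables (w : M -> R) (D : nat).
Local Notation C := (complex R).
Local Notation toC := (real_complex R).
Local Notation Im := (@complex.Im R).
Local Notation gamR := (gam t w).
Local Notation gamC := (gam t (toC \o w)).
Local Notation gamP := (gam t (polyC \o w)).

Hypothesis homog : forall m, w m != 0 -> \sum_j t m j = D.
Hypothesis stable : forall x : 'I_n -> C, (forall j, 0 < Im (x j)) ->
  gamC x (fun=> 0) != 0.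
Hypothesis positive : forall x : 'I_n -> R, (forall j, 0 < x j) ->
  0 < gamR x (fun=> 0).

(** Setting y_j = 0 outside [s] means that only the operators with index in [s] are applied. *)
Definition restr (K : comNzRingType) (s : seq 'I_n) (y : 'I_n -> K) : 'I_n -> K :=
  fun j => if j \in s then y j else 0.

Definition tubept (x v : 'I_n -> R) : 'I_n -> C := fun j => Complex (x j) (v j).

(* The hyperbolicity cone of the homogeneous polynomial gamR (x, restr s y) in
   the 2n variables (x, y). *)
Fixpoint cone (s : seq 'I_n) (v u : 'I_n -> R) : Prop :=
  if s is i :: s' then cone s' v u /\ 0 < gamR v (restr s u)
  else forall j, 0 < v j.

Lemma restr_cons (K : comNzRingType) i s (y : 'I_n -> K) : i \notin s ->
  restr (i :: s) y =1 upd (restr s y) i (y i).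
Proof.
by move=> ins l; rewrite /restr /upd inE; case: eqP => [->|].
Qed.

Lemma restr_notin (K : comNzRingType) i s (y : 'I_n -> K) : i \notin s ->
  restr s y i = 0.
Proof. by rewrite /restr => /negbTE ->. Qed.

Lemma gam_restr_cons (K : comNzRingType) (w' : M -> K) i s x y : i \notin s ->
  gam t w' x (restr (i :: s) y) =
  gam t w' x (restr s y) - y i * dgam t w' i x (restr s y).
Proof.
move=> ins; rewrite -gam_upd ?restr_notin //; apply: eq_gam => //.
exact: restr_cons.
Qed.

Lemma eq_cone s v u v' u' : v =1 v' -> {in s, u =1 u'} -> cone s v u -> cone s v' u'.
Proof.
elim: s v u v' u' => [|i s IH] v u v' u' hv hu /=; first by move=> h j; rewrite -hv.
case=> h1 h2; split.
  by apply: IH h1 => // j js; apply: hu; rewrite inE js orbT.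
suff <- : gamR v (restr (i :: s) u) = gamR v' (restr (i :: s) u') by [].
by apply: eq_gam => // j; rewrite /restr; case: ifP => // /hu.
Qed.

Lemma cone_gt0 s v u : cone s v u -> 0 < gamR v (restr s u).
Proof.
case: s => [|i s] /=; last by case.
by move=> /positive h; rewrite (eq_gam _ (w' := w) (x' := v) (y' := fun=> 0)).
Qed.

Lemma cone_orthant s v : (forall j, 0 < v j) -> cone s v (fun=> 0).
Proof.
move=> hv; elim: s => //= i s IH; split => //.
rewrite (eq_gam _ (w' := w) (x' := v) (y' := fun=> 0)) ?positive // => j.
by rewrite /restr; case: ifP.
Qed.

Lemma cone_scale s c v u : 0 < c -> cone s v u ->
  cone s (fun j => c * v j) (fun j => c * u j).
Proof.
move=> c0; elim: s => [|i s IH] /=; first by move=> h j; rewrite mulr_gt0.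
case=> /IH h1 h2; split => //.
have <- : gamR (fun j => c * v j) (fun j => c * restr (i :: s) u j) =
    gamR (fun j => c * v j) (restr (i :: s) (fun j => c * u j)).
  by apply: eq_gam => // j; rewrite /restr; case: ifP => _ //; rewrite mulr0.
by rewrite (gam_homog _ _ _ homog) mulr_gt0 // exprn_gt0.
Qed.

Lemma cone_open s v u : cone s v u ->
  exists2 e, 0 < e & forall x, 0 <= x <= e -> cone s (fun j => v j - x) u.
Proof.
have mine (P Q : R -> Prop) :
    (exists2 e, 0 < e & forall x, 0 <= x <= e -> P x) ->
    (exists2 e, 0 < e & forall x, 0 <= x <= e -> Q x) ->
    exists2 e, 0 < e & forall x, 0 <= x <= e -> P x /\ Q x.
  case=> e e0 he [f f0 hf]; exists (Num.min e f); first by rewrite lt_min e0.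
  move=> x; rewrite le_min => /and3P[x0 xe xf].
  by split; [apply: he|apply: hf]; rewrite x0.
elim: s => [|i s IH] /=.
  move=> hv; exists (\big[Num.min/1]_j (v j / 2)).
    by apply/bigmin_gtP; split => // j _; rewrite divr_gt0.
  move=> x /andP[x0 /bigmin_geP[_ hx]] j.
  rewrite subr_gt0; apply: le_lt_trans (hx j isT) _.
  by rewrite ltr_pdivrMr // mulr_natr mulr2n ltrDl.
case=> /IH h1 h2; apply: mine => //.
pose p := gamP (line v (fun=> -1)) (line (restr (i :: s) u) (fun=> 0)).
have pE x : p.[x] = gamR (fun j => v j - x) (restr (i :: s) u).
  by rewrite /p gam_line_eval; apply: eq_gam => // j; rewrite ?mulrN1 ?mulr0 ?addr0.
have /poly_pos_near0[e e0 he] : 0 < p.[0].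
  rewrite pE; congr (0 < _) : h2; apply: eq_gam => // j; by rewrite subr0.
by exists e => // x /he; rewrite pE.
Qed.

(** * Extending the cone by one more variable y_i *)

Section Step.
Variable s : seq 'I_n.
Hypothesis tube : forall x v y u, cone s v u ->
  gamC (tubept x v) (restr s (tubept y u)) != 0.
Hypothesis addcone : forall v u v' u', cone s v u -> cone s v' u' ->
  cone s (fun j => v j + v' j) (fun j => u j + u' j).

(** The point is (v - e) + (x + e) with e small: the first part stays in the cone by openness and
    the second is strictly positive. *)
Lemma cone_up v u x : (forall j, 0 <= x j) -> cone s v u ->
  cone s (fun j => v j + x j) u.
Proof.
move=> hx hv; have [e e0 he] := cone_open hv.
have h1 := he e; rewrite lexx ltW // in h1; have {}h1 := h1 isT.
have h2 : cone s (fun j => x j + e) (fun=> 0).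
  by apply: cone_orthant => j; rewrite ltr_wpDl.
apply: eq_cone (addcone h1 h2) => j; first by rewrite addrCA subrK addrC.
by rewrite addr0.
Qed.

(** Moving the j-th coordinate by [a] with Im a >= 0 stays in the tube, so the resulting polynomial
    in [a] has all its roots in the lower half plane, and its logarithmic derivative at 0 is the
    quotient. *)
Lemma tube_Im_dgam x v y u j : j \notin s -> cone s v u ->
  Im (dgam t (toC \o w) j (tubept x v) (restr s (tubept y u)) /
      gamC (tubept x v) (restr s (tubept y u))) <= 0.
Proof.
move=> js hv; set Z := tubept x v; set Y := restr s _.
pose p := gam t (polyC \o (toC \o w)) (line Z (fun l => (l == j)%:R)) (polyC \o Y).
have pE (a : C) : p.[a] = gamC (fun l => Z l + a * (l == j)%:R) Y.
  rewrite -[LHS]/(horner_eval a _) gam_morph; apply: eq_gam => l /=;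
    rewrite /horner_eval ?hornerC // /line !hornerE.
  by rewrite mulrC.
have p0 : p.[0] = gamC Z Y.
  by rewrite pE; apply: eq_gam => // l; rewrite mul0r addr0.
have dp0 : p^`().[0] = dgam t (toC \o w) j Z Y.
  rewrite deriv_gam; last exact: restr_notin.
  rewrite -[LHS]/(horner_eval 0 _) dgam_morph; apply: eq_dgam => l /=;
    rewrite /horner_eval ?hornerC // /line !hornerE.
  by [].
have nz (a : C) : 0 <= Im a -> p.[a] != 0.
  move=> a0; rewrite pE.
  have hv' : cone s (fun l => v l + Im a * (l == j)%:R) u.
    by apply: cone_up => // l; rewrite mulr_ge0.
  have := tube (fun l => x l + complex.Re a * (l == j)%:R) y hv'.
  congr (_ != 0); apply: eq_gam => // l; rewrite /Z /tubept.
  apply/eqP; rewrite eq_complex; case: a {a0 hv'} => a b /=.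
  by case: (l =P j) => _; rewrite ?(mulr1, mulr0, addr0, subr0, add0r) /= ?(mulr1, mulr0, addr0, subr0, add0r) ?eqxx.
have [] := @cIm_logderiv _ p 0.
- move=> z /rootP pz; rewrite leNgt; apply/negP => z0.
  by have := nz z (ltW z0); rewrite pz eqxx.
- by apply: nz.
by rewrite dp0 p0.
Qed.

(** At z in the upper half plane, the line through (x, a) in direction (v, b) has imaginary part Im
    z times (v, b), which is in the cone. Hence d_j f / f is Nevanlinna on the line, and its total
    weight depends on the direction only. *)
Lemma cone_decomp x v a b j : j \notin s -> cone s v b ->
  let q := gamP (line x v) (line (restr s a) (restr s b)) in
  let r := dgam t (polyC \o w) j (line x v) (line (restr s a) (restr s b)) in
  exists L : seq (R * R),
    [/\ forall p, p \in L -> 0 <= p.1 /\ root q p.2,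
        r = \sum_(p <- L) p.1 *: (q %/ ('X - (p.2)%:P)),
        \sum_(p <- L) p.1 = dgam t w j v (restr s b) / gamR v (restr s b) &
        forall z : C, 0 < Im z -> (map_poly toC q).[z] != 0].
Proof.
move=> js hv q r.
have gpos := cone_gt0 hv.
have [szq cq] := gam_line_lead x v (restr s a) (restr s b) homog.
have [szr cr] := dgam_line x v homog (restr_notin a js) (restr_notin b js).
rewrite -/q -/r in szq cq szr cr.
have sz : size q = D.+1.
  apply/eqP; rewrite eqn_leq szq /= ltnNge; apply/negP => /leq_sizeP/(_ D (leqnn _)).
  by rewrite cq => e; rewrite e ltxx in gpos.
pose Zx (z : C) l := x l + complex.Re z * v l.
pose Za (z : C) l := a l + complex.Re z * b l.
have ptE (z : C) (f g : 'I_n -> R) l :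
    (map_poly toC ((f l)%:P + g l *: 'X)).[z] =
    Complex (f l + complex.Re z * g l) (Im z * g l).
  rewrite rmorphD /= map_polyZ map_polyC map_polyX !hornerE /=.
  by case: z => z1 z2; apply/eqP; rewrite eq_complex /= !mul0r !addr0 ?subr0 ?add0r; apply/andP; split; apply/eqP; ring.
have hrestr (z : C) l : (map_poly toC (line (restr s a) (restr s b) l)).[z] =
    restr s (tubept (Za z) (fun j => Im z * b j)) l.
  rewrite ptE /restr /Za /tubept; case: (l \in s) => //.
  by rewrite !mulr0 addr0.
have mE (P : {poly R}) (z : C) : (map_poly toC P).[z] =
   (horner_eval z \o map_poly toC) P by [].
have qE (z : C) : (map_poly toC q).[z] =
   gamC (tubept (Zx z) (fun j => Im z * v j)) (restr s (tubept (Za z) (fun j => Im z * b j))).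
  rewrite mE gam_morph; apply: eq_gam => l /=; rewrite /horner_eval.
  - by rewrite map_polyC hornerC.
  - by rewrite ptE.
  - exact: hrestr.
have rE (z : C) : (map_poly toC r).[z] =
   dgam t (toC \o w) j (tubept (Zx z) (fun j => Im z * v j)) (restr s (tubept (Za z) (fun j => Im z * b j))).
  rewrite mE dgam_morph; apply: eq_dgam => l /=; rewrite /horner_eval.
  - by rewrite map_polyC hornerC.
  - by rewrite ptE.
  - exact: hrestr.
have nev : nevanlinna q r.
  move=> z z0; have hz := cone_scale z0 hv; rewrite qE rE; split.
    exact: tube.
  exact: tube_Im_dgam.
have [|L [hL eL]] := nevanlinna_decomp _ nev; first by rewrite sz ltnS.
exists L; split => //; last by move=> z /nev[].
have := nevanlinna_coef sz hL eL; rewrite cr cq => ->.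
by rewrite mulrAC mulfV ?mul1r // gt_eqF.
Qed.

(** The reciprocal of xi_j = f / d_j f. The condition y_j < xi_j becomes y_j * [phi] < 1, which
    remains meaningful when d_j f = 0. *)
Definition phi j v u := dgam t w j v (restr s u) / gamR v (restr s u).

Lemma phi_ge0 j v u : j \notin s -> cone s v u -> 0 <= phi j v u.
Proof.
move=> js hv; rewrite /phi; have [L [hL _ <- _]] := cone_decomp (fun=> 0) (fun=> 0) js hv.
by rewrite big_seq; apply: sumr_ge0 => p /hL[].
Qed.

(** On the line (v, u) + c (v', u'), the quotient at c = 0, at c = 1 and its total weight are the
    three values of [phi]. The poles are negative because f > 0 for c >= 0, so [parallel_sum]
    applies. *)
Lemma phi_le_add j v u v' u' : j \notin s -> cone s v u -> cone s v' u' ->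
  phi j (fun l => v l + v' l) (fun l => u l + u' l) <= phi j v' u' /\
  phi j (fun l => v l + v' l) (fun l => u l + u' l) * (phi j v u + phi j v' u') <=
  phi j v u * phi j v' u'.
Proof.
move=> js hv hv'.
have [L [hL eL sL _]] := cone_decomp v u js hv'.
set q := gamP _ _ in hL eL; set r := dgam _ _ _ _ _ in eL.
have hs (c : R) l : (line (restr s u) (restr s u') l).[c] = restr s (fun l => u l + c * u' l) l.
  by rewrite /line !hornerE /restr mulrC; case: ifP => // _; rewrite mulr0 addr0.
have qE c : q.[c] = gamR (fun l => v l + c * v' l) (restr s (fun l => u l + c * u' l)).
  rewrite -[LHS]/(horner_eval c _) gam_morph; apply: eq_gam => l /=;
    rewrite /horner_eval ?hornerC //.
  by rewrite !hornerE mulrC.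
have rE c : r.[c] = dgam t w j (fun l => v l + c * v' l) (restr s (fun l => u l + c * u' l)).
  rewrite -[LHS]/(horner_eval c _) dgam_morph; apply: eq_dgam => l /=;
    rewrite /horner_eval ?hornerC //.
  by rewrite !hornerE mulrC.
have qpos c : 0 <= c -> 0 < q.[c].
  rewrite qE le_eqVlt => /predU1P[<-|c0].
    apply: cone_gt0; apply: eq_cone hv => l *; by rewrite mul0r addr0.
  apply: cone_gt0; apply: addcone => //; exact: cone_scale.
have hL' p : p \in L -> 0 <= p.1 /\ p.2 < 0.
  move=> /hL[h1 h2]; split => //; rewrite ltNge; apply/negP => /qpos.
  by rewrite (rootP h2) ltxx.
have := parallel_sum hL'; rewrite sL.
rewrite -(nevanlinna_evalR hL eL) ?gt_eqF ?qpos // -(nevanlinna_evalR hL eL) ?gt_eqF ?qpos //.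
have e0 : r.[0] / q.[0] = phi j v u.
  rewrite qE rE; congr (_ / _); [apply: eq_dgam|apply: eq_gam] => // l;
    by rewrite /restr ?mul0r ?addr0.
have e1 : r.[1] / q.[1] = phi j (fun l => v l + v' l) (fun l => u l + u' l).
  rewrite qE rE; congr (_ / _); [apply: eq_dgam|apply: eq_gam] => // l;
    by rewrite /restr ?mul1r.
by rewrite e0 e1.
Qed.

Lemma cone_cons_phi j v u : j \notin s -> cone s v u ->
  (0 < gamR v (restr (j :: s) u)) = (u j * phi j v u < 1).
Proof.
move=> js hv; rewrite gam_restr_cons // subr_gt0.
by rewrite /phi mulrA ltr_pdivrMr ?mul1r //; apply: cone_gt0.
Qed.

(** The tube point is the value at 'i of the line through (x, y) in direction (v, u). A zero would
    make y_i + i u_i times the partial fractions equal to 1, which [tube_parallel_sum] forbids. *)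
Lemma tube_cons i x v y u : i \notin s -> cone (i :: s) v u ->
  gamC (tubept x v) (restr (i :: s) (tubept y u)) != 0.
Proof.
move=> js [hv]; rewrite cone_cons_phi // => hu.
have [L [hL eL sL nz]] := cone_decomp x y js hv.
set q := gamP _ _ in hL eL nz; set r := dgam _ _ _ _ _ in eL.
have hu' : u i * \sum_(p <- L) p.1 < 1 by rewrite sL.
have hL0 p : p \in L -> 0 <= p.1 by move=> /hL[].
have := tube_parallel_sum (y i) hL0 hu'.
have i0 : 0 < Im 'i%C by rewrite /= ltr01.
have nzi := nz _ i0.
rewrite -(nevanlinna_eval hL eL) //.
have mE (P : {poly R}) (z : C) : (map_poly toC P).[z] =
   (horner_eval z \o map_poly toC) P by [].
have hs l : (map_poly toC (line (restr s y) (restr s u) l)).['i%C] = restr s (tubept y u) l.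
  rewrite /line rmorphD /= map_polyZ map_polyC map_polyX !hornerE /=.
  apply/eqP; rewrite eq_complex /restr; case: (l \in s) => /=;
    by apply/andP; split; apply/eqP; ring.
have hx l : (map_poly toC (line x v l)).['i%C] = tubept x v l.
  rewrite /line rmorphD /= map_polyZ map_polyC map_polyX !hornerE /=.
  apply/eqP; rewrite eq_complex /=;
    by apply/andP; split; apply/eqP; ring.
have qE : (map_poly toC q).['i%C] = gamC (tubept x v) (restr s (tubept y u)).
  rewrite mE gam_morph; apply: eq_gam => l /=; rewrite /horner_eval //.
  by rewrite map_polyC hornerC.
have rE : (map_poly toC r).['i%C] = dgam t (toC \o w) i (tubept x v) (restr s (tubept y u)).
  rewrite mE dgam_morph; apply: eq_dgam => l /=; rewrite /horner_eval //.
  by rewrite map_polyC hornerC.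
rewrite qE in nzi; rewrite qE rE gam_restr_cons //.
apply: contraNneq => /eqP; rewrite subr_eq0 => /eqP e.
by rewrite mulrA -e mulfV.
Qed.

(** In terms of reciprocals: u_i + u'_i < 1 / A + 1 / B <= 1 / S, with A and B the values of [phi]
    at the two points and S its value at their sum. The remaining cases have S = 0 or u_i + u'_i <=
    0. *)
Lemma addcone_cons i v u v' u' : i \notin s -> cone (i :: s) v u ->
  cone (i :: s) v' u' ->
  cone (i :: s) (fun j => v j + v' j) (fun j => u j + u' j).
Proof.
move=> js [hv +] [hv' +]; have hvv := addcone hv hv'.
rewrite !cone_cons_phi // => h h'; split; rewrite ?cone_cons_phi //.
have [] := phi_le_add js hv hv'.
have := phi_ge0 js hvv; have := phi_ge0 js hv'; have := phi_ge0 js hv.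
move: h h'; set A := phi i v u; set B := phi i v' u'; set S := phi i _ _.
move: A B S => A B S h h' A0 B0 S0 hSB hS.
have [S00|Sn] := eqVneq S 0; first by rewrite S00 mulr0 ltr01.
have Sp : 0 < S by rewrite lt_neqAle eq_sym Sn.
have AB0 : 0 < A + B by lra.
rewrite -(ltr_pM2r AB0) mul1r -mulrA.
have [uu|uu] := leP (u i + u' i) 0.
  by apply: (le_lt_trans _ AB0); rewrite mulr_le0_ge0 // mulr_ge0 // ltW.
apply: (@le_lt_trans _ _ ((u i + u' i) * (A * B))); first exact: (ler_wpM2l (ltW uu) hS).
have Bp : 0 < B by lra.
have Ap : 0 < A.
  rewrite -(pmulr_lgt0 _ Bp); apply: lt_le_trans hS; exact: mulr_gt0.
have := ltr_pM2r Bp (u i * A) 1; rewrite h => h1.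
have := ltr_pM2r Ap (u' i * B) 1; rewrite h' => h2.
lra.
Qed.

End Step.

(** The two claims need a joint induction: nonvanishing on the tube gives the partial fractions
    behind additivity, and additivity (through [cone_up]) gives the sign of d_j f / f on the
    tube. *)
Lemma cone_tube_add s : uniq s ->
  (forall x v y u, cone s v u -> gamC (tubept x v) (restr s (tubept y u)) != 0) /\
  (forall v u v' u', cone s v u -> cone s v' u' ->
     cone s (fun j => v j + v' j) (fun j => u j + u' j)).
Proof.
elim: s => [|i s IH] /=; first split.
- move=> x v y u hv.
  rewrite (eq_gam _ (w' := toC \o w) (x' := tubept x v) (y' := fun=> 0)) //.
  exact: stable.
- by move=> v u v' u' h h' j; rewrite addr_gt0.
move=> /andP[ins us]; have [tube addcone] := IH us; split.
  by move=> x v y u; apply: tube_cons.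
by move=> v u v' u'; apply: addcone_cons.
Qed.

(** The degree is D - 1; writing [c ^+ D / c] covers D = 0 as well. *)
Lemma dgam_homog j c x y : 0 < c -> y j = 0 ->
  dgam t w j (fun l => c * x l) (fun l => c * y l) = c ^+ D / c * dgam t w j x y.
Proof.
move=> c0 yj; rewrite {1}/dgam (gam_homog _ _ _ homog).
have -> : gamR (fun l => c * x l) (upd (fun l => c * y l) j 1) =
    c ^+ D * gamR x (upd y j c^-1).
  rewrite -(gam_homog _ _ _ homog); apply: eq_gam => // l; rewrite /upd.
  by case: eqP => // _; rewrite mulfV // gt_eqF.
by rewrite gam_upd //; ring.
Qed.

Lemma phi_scale s j c v u : j \notin s -> 0 < c ->
  phi s j (fun l => c * v l) (fun l => c * u l) = phi s j v u / c.
Proof.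
move=> js c0; rewrite /phi.
have hm l : restr s (fun l => c * u l) l = c * restr s u l.
  by rewrite /restr; case: ifP => // _; rewrite mulr0.
rewrite (eq_dgam _ _ (w' := w) (x' := fun l => c * v l) (y' := fun l => c * restr s u l)) //.
rewrite (@eq_gam _ _ _ _ _ w _ (fun l => c * v l) _ (fun l => c * restr s u l)) //.
rewrite dgam_homog ?restr_notin // (gam_homog _ _ _ homog).
have cD : c ^+ D != 0 by rewrite expf_neq0 // gt_eqF.
have [g0|g0] := eqVneq (gamR v (restr s u)) 0; first by rewrite g0 mulr0 invr0 !mulr0 mul0r.
by field; rewrite g0 cD gt_eqF.
Qed.

(** [phi_le_add] asks for a strictly positive increment. So split v + x as (v - c) + (x + c) with c
    > 0, and let c tend to 0 in the cross-multiplied inequality, which is polynomial in c. *)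
Lemma phi_up s j v u x : uniq s -> j \notin s -> (forall l, 0 <= x l) ->
  cone s v u -> phi s j (fun l => v l + x l) u <= phi s j v u.
Proof.
move=> us js hx hv; have [tube addcone] := cone_tube_add us.
have [e e0 he] := cone_open hv.
have gv := cone_gt0 hv; have hvx := cone_up addcone hx hv; have gvx := cone_gt0 hvx.
rewrite /phi ler_pdivrMr // mulrAC ler_pdivlMr //.
pose pg := gamP (line v (fun=> -1)) (line (restr s u) (fun=> 0)).
pose pd := dgam t (polyC \o w) j (line v (fun=> -1)) (line (restr s u) (fun=> 0)).
have pgE c : pg.[c] = gamR (fun l => v l - c) (restr s u).
  by rewrite gam_line_eval; apply: eq_gam => // l; rewrite ?mulrN1 ?mulr0 ?addr0.
have pdE c : pd.[c] = dgam t w j (fun l => v l - c) (restr s u).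
  rewrite -[LHS]/(horner_eval c _) dgam_morph; apply: eq_dgam => l /=;
    by rewrite /horner_eval ?hornerC // /line !hornerE ?mulNr ?mul1r ?mul0r ?addr0.
pose F := pd * (gamR (fun l => v l + x l) (restr s u))%:P -
          pg * (dgam t w j (fun l => v l + x l) (restr s u))%:P.
have : 0 <= F.[0].
  apply: (poly_ge0_near0 e0) => c /andP[c0 ce].
  have hvc : cone s (fun l => v l - c) u by apply: he; rewrite ltW.
  have hxc : cone s (fun l => x l + c) (fun=> 0).
    by apply: cone_orthant => l; rewrite ltr_wpDl.
  have [+ _] := phi_le_add tube addcone js hxc hvc.
  have gvc := cone_gt0 hvc.
  have eq1 l : x l + c + (v l - c) = v l + x l by ring.
  have eq2 l : restr s (fun l => 0 + u l) l = restr s u l by rewrite /restr add0r.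
  rewrite /phi (eq_dgam _ _ (frefl w) eq1 eq2) (eq_gam _ (frefl w) eq1 eq2).
  rewrite ler_pdivrMr // mulrAC ler_pdivlMr // => h.
  by rewrite /F hornerD hornerN !hornerM !hornerC pdE pgE subr_ge0 [_ * dgam _ _ _ _ _]mulrC.
rewrite /F hornerD hornerN !hornerM !hornerC pdE pgE subr_ge0.
have eq0 l : v l - 0 = v l by rewrite subr0.
by rewrite (eq_dgam _ _ (frefl w) eq0 (frefl _)) (eq_gam _ (frefl w) eq0 (frefl _)) [_ * dgam _ _ _ _ _]mulrC.
Qed.

(* The concavity of q / r on [0, +oo[ is used at 0, b and b + h, letting h tend to 0. *)
Lemma barrier_shift (q r : {poly R}) (b kap : R) :
  0 < b -> 1 <= b * (1 - kap) ->
  (forall c, 0 <= c -> 0 < q.[c]) -> (forall c, 0 <= c -> 0 <= r.[c]) ->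
  (forall h, 0 < h -> r.[b + h] / q.[b + h] <= r.[b] / q.[b]) ->
  (forall h, 0 < h ->
     r.[b] / q.[b] * (b * (r.[0] / q.[0]) + h * (r.[b + h] / q.[b + h])) <=
     (b + h) * (r.[0] / q.[0]) * (r.[b + h] / q.[b + h])) ->
  r.[0] / q.[0] <= kap -> q^`().[b] <= kap * q.[b] ->
  r.[b] - r^`().[b] <= kap * (q.[b] - q^`().[b]).
Proof.
move=> b0 hb qpos rge0 dec chord h0 hq.
pose Q := q \Po ('X + b%:P); pose S := r \Po ('X + b%:P).
have shE (p : {poly R}) h : (p \Po ('X + b%:P)).[h] = p.[b + h].
  by rewrite horner_comp !hornerE addrC.
have shD (p : {poly R}) : (p \Po ('X + b%:P))^`().[0] = p^`().[b].
  by rewrite deriv_comp hornerM horner_comp derivD derivX derivC !hornerE.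
have q0 := qpos 0 (lexx _); have qb := qpos b (ltW b0).
have r0 := rge0 0 (lexx _); have rb := rge0 b (ltW b0).
(* The derivative of r / q at [b] is nonpositive. *)
have Nge0 : 0 <= r.[b] * q^`().[b] - q.[b] * r^`().[b].
  pose G := r.[b] *: Q - q.[b] *: S.
  have -> : r.[b] * q^`().[b] - q.[b] * r^`().[b] = G^`().[0].
    by rewrite /G derivB !derivZ hornerD hornerN !hornerZ !shD.
  apply: (@poly_deriv_ge0_near0 _ _ 1) => //.
    by rewrite /G hornerD hornerN !hornerZ !shE addr0 mulrC subrr.
  move=> h /andP[hp _]; rewrite /G hornerD hornerN !hornerZ !shE subr_ge0.
  have qh : 0 < q.[b + h] by apply: qpos; lra.
  have := dec h hp; rewrite ler_pdivrMr // mulrAC ler_pdivlMr //.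
  by rewrite [r.[b + h] * _]mulrC.
(* The chord inequality is an equality at h = 0; after clearing denominators, its derivative there
   gives this bound: q / r lies below its tangent at [b] when evaluated at 0. *)
have star : r.[b] ^+ 2 * q.[0] + b * r.[0] * (r.[b] * q^`().[b] - q.[b] * r^`().[b]) <=
    r.[0] * q.[b] * r.[b].
  pose F := ('X + b%:P) * ((r.[0] * q.[b]) *: S) -
            r.[b] *: ((b * r.[0]) *: Q + 'X * (q.[0] *: S)).
  rewrite -subr_ge0.
  have -> : r.[0] * q.[b] * r.[b] - (r.[b] ^+ 2 * q.[0] +
      b * r.[0] * (r.[b] * q^`().[b] - q.[b] * r^`().[b])) = F^`().[0].
    rewrite /F derivB !derivZ derivD !derivM !derivZ derivD derivX derivC addr0 !mul1r.
    rewrite !(hornerD, hornerN, hornerZ, hornerM, hornerX, hornerC) !shD !shE addr0.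
    ring.
  apply: (@poly_deriv_ge0_near0 _ _ 1) => //.
    rewrite /F !(hornerD, hornerN, hornerZ, hornerM, hornerX, hornerC) !shE addr0; ring.
  move=> h /andP[hp _].
  have qh : 0 < q.[b + h] by apply: qpos; lra.
  rewrite /F !(hornerD, hornerN, hornerZ, hornerM, hornerX, hornerC) !shE subr_ge0.
  have := ler_wpM2r (ltW (mulr_gt0 (mulr_gt0 qb q0) qh)) (chord h hp).
  congr (_ <= _); field; rewrite ?gt_eqF //.
(* Because q' <= kap q at [b], applying 1 - d/dx loses at most the factor 1 - kap >= 1 / b. *)
have S0 : q.[b] <= b * (q.[b] - q^`().[b]).
  apply: (@le_trans _ _ (b * ((1 - kap) * q.[b]))).
    by rewrite mulrA ler_peMl // ltW.
  rewrite ler_pM2l //; lra.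
have Sp : 0 < q.[b] - q^`().[b] by rewrite -(pmulr_rgt0 _ b0); apply: lt_le_trans S0.
have [r00|rn0] := eqVneq r.[0] 0.
  rewrite r00 in star h0.
  have rb0 : r.[b] = 0.
    have : r.[b] ^+ 2 * q.[0] <= 0 by lra.
    by rewrite pmulr_lle0 // => h; apply/eqP; rewrite -sqrf_eq0 eq_le h sqr_ge0.
  have rb' : 0 <= r^`().[b].
    rewrite -shD; apply: (@poly_deriv_ge0_near0 _ _ 1) => //; first by rewrite shE addr0.
    by move=> h /andP[hp _]; rewrite shE; apply: rge0; lra.
  rewrite rb0; apply: (@le_trans _ _ 0); first by lra.
  by rewrite mulr_ge0 ?(ltW Sp) //; move: h0; rewrite mul0r.
have rp : 0 < r.[0] by rewrite lt_neqAle eq_sym rn0.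
set N := r.[b] * _ - _ in Nge0 star.
set f := r.[0] / q.[0] in h0.
have fp : 0 < f by rewrite divr_gt0.
have star' : b * f * N <= r.[b] * (f * q.[b] - r.[b]).
  rewrite -(ler_pM2r q0) /f.
  have -> : b * (r.[0] / q.[0]) * N * q.[0] = b * r.[0] * N by field; rewrite gt_eqF.
  have -> : r.[b] * (r.[0] / q.[0] * q.[b] - r.[b]) * q.[0] =
     r.[0] * q.[b] * r.[b] - r.[b] ^+ 2 * q.[0] by field; rewrite gt_eqF.
  lra.
apply: (@le_trans _ _ (f * (q.[b] - q^`().[b]))); last by rewrite ler_pM2r.
rewrite -(ler_pM2r (mulr_gt0 fp (mulr_gt0 qb qb))).
set S' := q.[b] - _ in S0 Sp *.
have -> : (r.[b] - r^`().[b]) * (f * (q.[b] * q.[b])) =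
   f * q.[b] * (r.[b] * S') + f * q.[b] * N by rewrite /N /S'; ring.
have h1 : f * q.[b] * N <= S' * (r.[b] * (f * q.[b] - r.[b])).
  apply: (@le_trans _ _ (S' * (b * f * N))); last by rewrite ler_pM2l.
  have -> : S' * (b * f * N) = f * N * (b * S') by ring.
  have -> : f * q.[b] * N = f * N * q.[b] by ring.
  by rewrite ler_wpM2l // mulr_ge0 // ltW.
apply: (@le_trans _ _ (f * q.[b] * (r.[b] * S') + S' * (r.[b] * (f * q.[b] - r.[b])))).
  by rewrite lerD2l.
(* What remains after using [star'] and [S0] is a perfect square times the positive [S']. *)
rewrite -subr_ge0.
have -> : f * S' * (f * (q.[b] * q.[b])) -
  (f * q.[b] * (r.[b] * S') + S' * (r.[b] * (f * q.[b] - r.[b]))) =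
  S' * (f * q.[b] - r.[b]) ^+ 2 by ring.
by rewrite mulr_ge0 ?sqr_ge0 // ltW.
Qed.

(** * The barrier argument and the averaging *)

Section Barrier.
Variables (alpha t0 b kap : R).
Hypothesis trace : forall j,
  dgam t w j (fun=> 1) (fun=> 0) <= alpha * gamR (fun=> 1) (fun=> 0).
Hypothesis alpha_gt0 : 0 < alpha.
Hypothesis kap_gt0 : 0 < kap.
Hypothesis kapt0 : alpha < kap * t0.
Hypothesis b_gt0 : 0 < b.
Hypothesis bkap : 1 <= b * (1 - kap).

(** Coordinates whose operator has been applied are shifted by [b]. The free slack [x] lets the
    induction hypothesis be used along the whole half-line in the next direction. *)
Definition barpt (s : seq 'I_n) (x : 'I_n -> R) : 'I_n -> R :=
  fun j => t0 + b * (j \in s)%:R + x j.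

Lemma eq_phi s j v v' u u' : v =1 v' -> u =1 u' -> phi s j v u = phi s j v' u'.
Proof.
move=> hv hu; congr (_ / _); [apply: eq_dgam|apply: eq_gam] => // l;
  by rewrite /restr hu.
Qed.

(** Each new operator 1 - d/dx_i may raise the remaining ratios d_j f / f, and the shift by [b] in
    coordinate i compensates for it; [barrier_shift] is this exchange. *)
Lemma barrier s : uniq s -> forall x, (forall j, 0 <= x j) ->
  cone s (barpt s x) (fun=> 1) /\
  forall j, j \notin s -> phi s j (barpt s x) (fun=> 1) <= kap.
Proof.
have t00 : 0 < t0 by rewrite -(pmulr_rgt0 _ kap_gt0) (lt_trans alpha_gt0).
elim: s => [_ x hx|i s IH].
  split=> [j|j _]; first by rewrite /barpt mulr0 addr0 ltr_wpDr.
  (* At c 1 the ratio is at most alpha / c = kap. Since c < [t0], the difference from c 1 to the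
     actual point is strictly positive, and [phi] only decreases. *)
  pose c := alpha / kap.
  have c0 : 0 < c by rewrite divr_gt0.
  have ct : 0 < t0 - c by rewrite subr_gt0 /c ltr_pdivrMr // mulrC.
  have [tube addcone] := @cone_tube_add [::] isT.
  have hc : cone [::] (fun=> c * 1) (fun=> c * 0) by move=> l; rewrite mulr1.
  have hx' : cone [::] (fun l => x l + (t0 - c)) (fun=> 1) by move=> l; rewrite ltr_wpDl.
  have [+ _] := phi_le_add tube addcone (isT : j \notin [::]) hx' hc.
  rewrite (@phi_scale [::] j c (fun=> 1) (fun=> 0)) // => h.
  apply: (@le_trans _ _ (phi [::] j (fun=> 1) (fun=> 0) / c)).
    apply: le_trans h; rewrite le_eqVlt; apply/orP; left; apply/eqP.
    have e l : barpt [::] x l = x l + (t0 - c) + c * 1 by rewrite /barpt mulr0; ring.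
    rewrite /phi; congr (_ / _); [apply: eq_dgam|apply: eq_gam] => // l; by rewrite /restr.
  rewrite ler_pdivrMr // /c mulrC divfK ?gt_eqF // /phi ler_pdivrMr; last first.
    exact: (@cone_gt0 [::] (fun=> 1) (fun=> 0)).
  exact: trace.
move=> /= /andP[ins us] x hx.
have {}IH := IH us; have [tube addcone] := cone_tube_add us.
pose P c l := barpt s x l + c * (l == i)%:R.
have PE c l : P c l = barpt s (fun l => x l + c * (l == i)%:R) l.
  by rewrite /P /barpt addrA.
have hP c : 0 <= c -> cone s (P c) (fun=> 1) /\
    forall j, j \notin s -> phi s j (P c) (fun=> 1) <= kap.
  move=> c0; have [|h1 h2] := IH (fun l => x l + c * (l == i)%:R).
    by move=> l; rewrite addr_ge0 // mulr_ge0.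
  split; first by apply: eq_cone h1 => // l; rewrite PE.
  by move=> j /h2; rewrite (eq_phi _ _ (PE c) (frefl _)).
have Pb l : P b l = barpt (i :: s) x l.
  rewrite /P /barpt inE; have [->|_] /= := eqVneq l i; last by rewrite mulr0 addr0.
  by rewrite (negbTE ins) /=; ring.
pose Y : 'I_n -> R := restr s (fun=> 1).
have Yi : Y i = 0 by apply: restr_notin.
pose q := gamP (line (barpt s x) (fun l => (l == i)%:R)) (polyC \o Y).
have lineE c l : (line (barpt s x) (fun l => (l == i)%:R) l).[c] = P c l.
  by rewrite /line !hornerE mulrC.
have qE c : q.[c] = gamR (P c) Y.
  rewrite -[LHS]/(horner_eval c _) gam_morph; apply: eq_gam => l /=;
    by rewrite /horner_eval ?hornerC.
have q'E c : q^`().[c] = dgam t w i (P c) Y.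
  rewrite deriv_gam // -[LHS]/(horner_eval c _) dgam_morph; apply: eq_dgam => l /=;
    by rewrite /horner_eval ?hornerC.
have coneb := hP b (ltW b_gt0).
have gb := cone_gt0 coneb.1.
have kap1 : kap < 1.
  rewrite ltNge; apply/negP => k1.
  have h1 : b * (1 - kap) <= 0 by rewrite mulr_ge0_le0 ?subr_le0 // ltW.
  by have := le_trans bkap h1; rewrite ler10.
have gpos : 0 < gamR (P b) (restr (i :: s) (fun=> 1)).
  rewrite (cone_cons_phi ins coneb.1) mul1r.
  by apply: le_lt_trans kap1; apply: coneb.2.
have gposE : gamR (P b) (restr (i :: s) (fun=> 1)) = q.[b] - q^`().[b].
  by rewrite gam_restr_cons // mul1r qE q'E.
split.
  split; first exact: eq_cone coneb.1.
  by rewrite -(eq_gam t (frefl w) Pb (frefl _)).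
move=> j; rewrite inE negb_or => /andP[ji js].
rewrite -(eq_phi (i :: s) j Pb (frefl _)) /phi.
rewrite ler_pdivrMr // gposE.
pose Yj := upd Y j 1.
have Yji : Yj i = 0 by rewrite /Yj /upd eq_sym (negbTE ji).
pose r := q - gamP (line (barpt s x) (fun l => (l == i)%:R)) (polyC \o Yj).
have rE c : r.[c] = dgam t w j (P c) Y.
  rewrite /r hornerD hornerN qE /dgam; congr (_ - _).
  rewrite -[LHS]/(horner_eval c _) gam_morph; apply: eq_gam => l /=;
    by rewrite /horner_eval ?hornerC.
have r'E c : r^`().[c] = dgam t w i (P c) Y - dgam t w i (P c) Yj.
  rewrite /r derivB hornerD hornerN q'E; congr (_ - _).
  rewrite deriv_gam // -[LHS]/(horner_eval c _) dgam_morph; apply: eq_dgam => l /=;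
    by rewrite /horner_eval ?hornerC.
have -> : dgam t w j (P b) (restr (i :: s) (fun=> 1)) = r.[b] - r^`().[b].
  rewrite rE r'E {1}/dgam gam_restr_cons // mul1r -/Y.
  have -> : gamR (P b) (upd (restr (i :: s) (fun=> 1)) j 1) =
            gamR (P b) Yj - dgam t w i (P b) Yj.
    rewrite -[X in _ = _ - X]mul1r -gam_upd //; apply: eq_gam => // l.
    rewrite /Yj /Y /upd /restr inE; case: (l =P j) => [->|_].
      by rewrite (negbTE ji).
    by case: (l =P i).
  rewrite /dgam -/Yj; ring.
have phiE c : phi s j (P c) (fun=> 1) = r.[c] / q.[c] by rewrite qE rE.
have coneP c (c0 : 0 <= c) := (hP c c0).1.
apply: barrier_shift => //.
- by move=> c c0; rewrite qE; apply: (cone_gt0 (coneP c c0)).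
- move=> c c0; have := phi_ge0 tube addcone js (coneP c c0).
  rewrite phiE pmulr_lge0 // invr_gt0 qE; exact: (cone_gt0 (coneP c c0)).
- move=> h h0; rewrite -!phiE.
  have -> : phi s j (P (b + h)) (fun=> 1) =
      phi s j (fun l => P b l + h * (l == i)%:R) (fun=> 1).
    by apply: eq_phi => // l; rewrite /P mulrDl addrA.
  by apply: phi_up => // [l|]; [rewrite mulr_ge0 // ltW | apply: coneP; exact: ltW].
(* P b is the convex combination (h P 0 + b P (b + h)) / (b + h), and y = 1 at all three points;
   this is superadditivity of 1 / [phi] after rescaling. *)
- move=> h h0; rewrite -!phiE.
  have bh : 0 < b + h by rewrite addr_gt0.
  have c1 := cone_scale h0 (coneP 0 (lexx _)).
  have c2 := cone_scale b_gt0 (coneP (b + h) (ltW bh)).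
  have [_] := phi_le_add tube addcone js c1 c2.
  move=> /(ler_wpM2r (ltW (mulr_gt0 bh (mulr_gt0 h0 b_gt0)))).
  rewrite (phi_scale _ _ js h0) (phi_scale _ _ js b_gt0).
  have -> : phi s j (fun l => h * P 0 l + b * P (b + h) l) (fun=> h * 1 + b * 1) =
      phi s j (P b) (fun=> 1) / (b + h).
    rewrite -(phi_scale _ _ js bh); apply: eq_phi => l; last by ring.
    by rewrite /P; ring.
  set A := phi _ _ _ _; set B := phi _ _ _ _; set E := phi _ _ _ _.
  congr (_ <= _); field; rewrite ?gt_eqF //.
- by rewrite -phiE; apply: (hP 0 (lexx _)).2.
rewrite q'E qE -ler_pdivrMr; first exact: coneb.2.
exact: gb.
Qed.

(* Each of the n summands leaves one coordinate i unshifted but has y_i = a > 1;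
   averaging over i within the convex cone gives the factor n - 1 + a. *)
Lemma barrier_average (a : R) : (0 < n)%N -> a * kap < 1 ->
  0 < gamR (fun=> n%:R * t0 + n.-1%:R * b) (fun=> n.-1%:R + a).
Proof.
move=> n0 ak.
pose v i (j : 'I_n) : R := t0 + b * (j != i)%:R.
pose u i (j : 'I_n) : R := if j == i then a else 1.
have vu_gt0 i s : uniq s -> 0 < gamR (v i) (restr s (u i)).
  move=> us; have [iins|ins] := boolP (i \in s); last first.
    (* The slack supplies the shift [b] outside [s], so that [v i] is the same point for every [s],
       as all nested conditions of the cone require. *)
    have hx j : 0 <= b * ((j != i) && (j \notin s))%:R by rewrite mulr_ge0 // ltW.
    have [h _] := barrier us hx.
    have := cone_gt0 h; congr (0 < _); apply: eq_gam => // j.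
      rewrite /barpt /v; case: (j =P i) => [->|_] /=; first by rewrite (negbTE ins) !mulr0 !addr0.
      by case: (j \in s) => /=; rewrite ?mulr0 ?addr0.
    rewrite /restr /u; case: ifP => // js; case: eqP => // ji.
    by rewrite -ji js in ins.
  have urem := rem_uniq i us.
  have hx j : 0 <= b * ((j != i) && (j \notin rem i s))%:R by rewrite mulr_ge0 // ltW.
  have irem : i \notin rem i s by rewrite mem_rem_uniq // inE eqxx.
  have [h /(_ i irem)] := barrier urem hx.
  have g0 := cone_gt0 h; move: h => _; rewrite /phi ler_pdivrMr // => hk.
  set x := barpt _ _ in g0 hk.
  have -> : gamR (v i) (restr s (u i)) = gamR x (upd (restr (rem i s) (fun=> 1)) i a).
    apply: eq_gam => // j.
      rewrite /x /barpt /v; case: (j =P i) => [->|_] /=; first by rewrite (negbTE irem) !mulr0 !addr0.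
      by case: (j \in rem i s) => /=; rewrite ?mulr0 ?addr0.
    rewrite /restr /upd /u; case: (j =P i) => [->|/eqP ji]; first by rewrite iins.
    by rewrite mem_rem_uniq // inE ji.
  rewrite gam_upd ?restr_notin // subr_gt0.
  have [a0|a0] := leP a 0.
    apply: le_lt_trans g0; rewrite mulr_le0_ge0 //.
    have [tube addcone] := cone_tube_add urem.
    have [h _] := barrier urem hx.
    have := phi_ge0 tube addcone irem h.
    rewrite /phi pmulr_lge0 // invr_gt0; exact: cone_gt0 h.
  apply: (@le_lt_trans _ _ (a * (kap * gamR x (restr (rem i s) (fun=> 1))))).
    by rewrite ler_pM2l.
  by rewrite mulrA gtr_pMl.
have hvu i s : uniq s -> cone s (v i) (u i).
  elim: s => [_ j|h s IH us]; last by move: (us) => /andP[_ us']; split; [apply: IH|apply: vu_gt0].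
  by rewrite /v ltr_wpDr // ?mulr_ge0 // ?ltW // -(pmulr_rgt0 _ kap_gt0) (lt_trans alpha_gt0).
have us := enum_uniq 'I_n; set s := enum 'I_n in us.
have [_ addcone] := cone_tube_add us.
have hsum (l : seq 'I_n) i0 : cone s (fun j => \sum_(i <- i0 :: l) v i j)
     (fun j => \sum_(i <- i0 :: l) u i j).
  elim: l i0 => [|i1 l IH] i0.
    by apply: eq_cone (hvu i0 s us) => j *; rewrite big_seq1.
  by apply: eq_cone (addcone _ _ _ _ (hvu i0 s us) (IH i1)) => j *; rewrite [RHS]big_cons.
have ne : exists i0 l, s = i0 :: l.
  have : (size s == n)%N by rewrite size_enum_ord.
  case: (s) => [|i0 l _]; last by exists i0, l.
  by rewrite /= eq_sym => /eqP n00; rewrite n00 in n0.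
case: ne => i0 [l sE]; have := hsum l i0; rewrite -sE => /cone_gt0.
have cnt j : \sum_(i <- s) (j != i)%:R = n.-1%:R :> R.
  rewrite big_enum /= -natr_sum; congr (_%:R).
  rewrite (eq_bigr (fun i => nat_of_bool (i != j))); last by move=> i _; rewrite eq_sym.
  by rewrite -big_mkcond sum1_card cardC1 card_ord.
congr (0 < _); apply: eq_gam => // j.
  rewrite /v big_split /= -mulr_sumr cnt big_enum /= sumr_const card_ord.
  by rewrite mulr_natl [b * _]mulrC.
rewrite /restr mem_enum inE /u.
rewrite (eq_bigr (fun i => (j != i)%:R + a * (j == i)%:R)); last first.
  by move=> i _; case: eqP => _ /=; rewrite ?mulr1 ?mulr0 ?add0r ?addr0.
rewrite big_split /= cnt; congr (_ + _).
rewrite big_enum /= (bigD1 j) //= eqxx mulr1 big1 ?addr0 // => i.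
by rewrite eq_sym => /negbTE ->; rewrite mulr0.
Qed.

End Barrier.
End Cone.

(** * Optimisation of the barrier parameters *)

Section Numeric.
Variables (R : rcfType) (n : nat) (M : finType) (t : M -> 'I_n -> nat).
Variables (w : M -> R) (D : nat).

Lemma mixed_bound (alpha T : R) :
  (forall m, w m != 0 -> \sum_j t m j = D) ->
  (forall x : 'I_n -> complex R, (forall j, 0 < complex.Im (x j)) ->
    gam t (real_complex R \o w) x (fun=> 0) != 0) ->
  (forall x : 'I_n -> R, (forall j, 0 < x j) -> 0 < gam t w x (fun=> 0)) ->
  (forall j, dgam t w j (fun=> 1) (fun=> 0) <= alpha * gam t w (fun=> 1) (fun=> 0)) ->
  (0 < n)%N -> n%:R^-1 < alpha ->
  (1 - n%:R^-1 + Num.sqrt (alpha - n%:R^-1 * (1 - n%:R^-1))) ^+ 2 < T ->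
  0 < gam t w (fun=> T) (fun=> 1).
Proof.
move=> homog stable positive trace n0 alphan hT.
set v : R := n%:R^-1 in alphan hT.
have N0 : 0 < n%:R :> R by rewrite ltr0n.
have v0 : 0 < v by rewrite invr_gt0.
have v1 : v <= 1 by rewrite invf_le1 // ler1n.
have Nv : n%:R = v^-1 :> R by rewrite invrK.
pose c := 1 - v; have c0 : 0 <= c by rewrite subr_ge0.
set W := Num.sqrt _ in hT.
have W2 : W ^+ 2 = alpha - v * c.
  rewrite sqr_sqrtr // subr_ge0 (le_trans _ (ltW alphan)) // ler_piMr ?(ltW v0) //.
  by rewrite lerBlDr lerDl ltW.
have W0 : 0 <= W := sqrtr_ge0 _.
(* This uses 1 / n < alpha, and amounts to b > 1 since b - 1 = W - v. *)
have Wv : v < W.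
  rewrite -(ltr_pXn2r (ltn0Sn 1)) ?nnegrE ?(ltW v0) // W2 /c; nra.
pose b := c + W; have b1 : 1 < b by rewrite /b /c; lra.
have b0 : 0 < b by lra.
have bm : 0 < b - 1 by lra.
pose a0 := b / (b - 1).
have T0 : 0 < T by apply: lt_trans hT; rewrite exprn_gt0.
have n1 : n.-1%:R = v^-1 * c :> R.
  by rewrite -subn1 natrB // Nv /c; field; do ?[apply/andP; split]; apply/eqP; lra.
(* The excess of T over the limiting ratio, times the denominator n - 1 + [a0]. Half of it is spent
   on lowering [a] below [a0] = 1 / kap, the other half on raising [t0] above alpha / kap. *)
pose m := T * (v^-1 * c + a0) - v^-1 * c * b - v^-1 * alpha * a0.
have m0 : 0 < m.
  have : b ^+ 2 * (v^-1 * c + a0) - v^-1 * c * b - v^-1 * alpha * a0 = 0.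
    have -> : alpha = W ^+ 2 + v * c by rewrite W2; ring.
    have bmE : b - 1 = W - v by rewrite /b /c; ring.
    rewrite /a0 bmE /b /c; field; do ?[apply/andP; split]; apply/eqP; lra.
  have : b ^+ 2 * (v^-1 * c + a0) < T * (v^-1 * c + a0).
    by rewrite ltr_pM2r // ltr_wpDl ?divr_gt0 // mulr_ge0 // invr_ge0 ltW.
  rewrite /m; lra.
pose kap := 1 - b^-1.
have kapE : kap = (b - 1) / b by rewrite /kap; field; do ?[apply/andP; split]; apply/eqP; lra.
have kap0 : 0 < kap by rewrite kapE divr_gt0.
have ka0 : kap * a0 = 1 by rewrite kapE /a0; field; do ?[apply/andP; split]; apply/eqP; lra.
pose a := a0 - m / (2 * T).
pose t0 := v * (T * (v^-1 * c + a) - v^-1 * c * b).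
have Ta : T * (v^-1 * c + a) = T * (v^-1 * c + a0) - m / 2.
  by rewrite /a; field; do ?[apply/andP; split]; apply/eqP; lra.
have mp : 0 < m / 2 by rewrite divr_gt0.
have al0 : 0 < alpha by apply: lt_trans alphan.
have ht0 : alpha < kap * t0.
  have -> : kap * t0 = (kap * a0) * alpha + v * kap * (m / 2).
    rewrite /t0 Ta.
    have -> : T * (v^-1 * c + a0) = m + v^-1 * c * b + v^-1 * alpha * a0 by rewrite /m; ring.
    by field; do ?[apply/andP; split]; apply/eqP; lra.
  by rewrite ka0 mul1r ltrDl mulr_gt0 // mulr_gt0.
have hb : 1 <= b * (1 - kap) by rewrite /kap subKr mulfV ?gt_eqF.
have hak : a * kap < 1.
  rewrite /a mulrBl [a0 * _]mulrC ka0 ltrBlDr ltrDl mulr_gt0 // divr_gt0 // mulr_gt0 //.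
have t00 : 0 < t0 by rewrite -(pmulr_rgt0 _ kap0) (lt_trans al0).
have := barrier_average homog stable positive trace al0 kap0 ht0 b0 hb n0 hak.
have -> : n%:R * t0 + n.-1%:R * b = (v^-1 * c + a) * T.
  by rewrite Nv n1 /t0; field; do ?[apply/andP; split]; apply/eqP; lra.
rewrite n1; set l := v^-1 * c + a.
have l0 : 0 < l.
  rewrite -(pmulr_rgt0 _ T0) Ta.
  have -> : T * (v^-1 * c + a0) = m + v^-1 * c * b + v^-1 * alpha * a0 by rewrite /m; ring.
  have h1 : 0 <= v^-1 * c * b by rewrite !mulr_ge0 // ?invr_ge0 ltW.
  have h2 : 0 < v^-1 * alpha * a0 by rewrite !mulr_gt0 ?invr_gt0 // divr_gt0.
  lra.
have -> : gam t w (fun=> l * T) (fun=> l) = l ^+ D * gam t w (fun=> T) (fun=> 1).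
  rewrite -(gam_homog _ _ _ homog); apply: eq_gam => // j; by rewrite mulr1.
by rewrite pmulr_rgt0 // exprn_gt0.
Qed.

End Numeric.

(** * The polarised polynomial with k copies of each variable *)

Section Rows.
Variables (n k : nat).
Local Notation family := {ffun 'I_k -> {set 'I_n}}.

Definition unitv (K : comNzRingType) (i : 'I_k) : 'I_k -> K := fun l => (l == i)%:R.

(* The image of prod_(i in S) z_i under 1 - sum_i c_i d/dz_i. *)
Definition rowfac (K : comNzRingType) (S : {set 'I_k}) (z c : 'I_k -> K) : K :=
  \prod_(i in S) z i - \sum_(i in S) c i * \prod_(l in S :\ i) z l.

Definition row_of (A : family) (j : 'I_n) : {set 'I_k} := [set i | j \in A i].

(* A polarisation of [gam]: the i-th factor of the power has its own copy
   z_(1,i), ..., z_(n,i) of the variables. *)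
Definition rgam (K : comNzRingType) (w : family -> K) (z c : 'I_n -> 'I_k -> K) : K :=
  \sum_A w A * \prod_j rowfac (row_of A j) (z j) (c j).

(** The partial derivative in z_(j,i), provided that the row c_j is zero. *)
Definition drgam (K : comNzRingType) (w : family -> K) j i (z c : 'I_n -> 'I_k -> K) : K :=
  rgam w z c - rgam w z (upd c j (unitv K i)).

Lemma eq_rowfac (K : comNzRingType) S (z z' c c' : 'I_k -> K) :
  z =1 z' -> c =1 c' -> rowfac S z c = rowfac S z' c'.
Proof.
move=> hz hc; congr (_ - _); first by apply: eq_bigr => i _.
apply: eq_bigr => i _; rewrite hc; congr (_ * _); by apply: eq_bigr => l _.
Qed.

Lemma eq_rgam (K : comNzRingType) (w w' : family -> K) (z z' c c' : 'I_n -> 'I_k -> K) :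
  w =1 w' -> z =2 z' -> c =2 c' -> rgam w z c = rgam w' z' c'.
Proof.
move=> hw hz hc; apply: eq_bigr => A _; rewrite hw; congr (_ * _).
by apply: eq_bigr => j _; apply: eq_rowfac.
Qed.

Lemma eq_drgam (K : comNzRingType) (w w' : family -> K) j i (z z' c c' : 'I_n -> 'I_k -> K) :
  w =1 w' -> z =2 z' -> c =2 c' -> drgam w j i z c = drgam w' j i z' c'.
Proof.
move=> hw hz hc; congr (_ - _); apply: eq_rgam => // l h.
by rewrite /upd; case: eqP.
Qed.

Lemma rowfac0 (K : comNzRingType) S (z : 'I_k -> K) :
  rowfac S z (fun=> 0) = \prod_(i in S) z i.
Proof. by rewrite /rowfac [X in _ - X]big1 ?subr0 // => i _; rewrite mul0r. Qed.

Lemma rowfac_unitv (K : comNzRingType) S (z : 'I_k -> K) i :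
  rowfac S z (fun=> 0) - rowfac S z (unitv K i) =
  if i \in S then \prod_(l in S :\ i) z l else 0.
Proof.
rewrite rowfac0 /rowfac subKr; case: ifP => iS.
  rewrite (bigD1 i) //= /unitv eqxx mul1r [X in _ + X]big1 ?addr0 // => l /andP[_ /negbTE ->].
  by rewrite mul0r.
rewrite big1 // => l lS; rewrite /unitv; case: eqP => [e|_]; last by rewrite mul0r.
by rewrite e iS in lS.
Qed.

Lemma rowfacE (K : comNzRingType) S (z c : 'I_k -> K) :
  rowfac S z c = rowfac S z (fun=> 0) -
    \sum_i c i * (rowfac S z (fun=> 0) - rowfac S z (unitv K i)).
Proof.
rewrite {1}/rowfac rowfac0; congr (_ - _); rewrite big_mkcond; apply: eq_bigr => i _.
by rewrite -(rowfac0 S z) rowfac_unitv; case: ifP => // _; rewrite mulr0.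
Qed.

(** A product of distinct variables is affine in z_i, so its first-order Taylor expansion is
    exact. *)
Lemma rowfac_shift (K : comNzRingType) S (z : 'I_k -> K) i a :
  rowfac S (fun l => z l + a * unitv K i l) (fun=> 0) =
  rowfac S z (fun=> 0) + a * (rowfac S z (fun=> 0) - rowfac S z (unitv K i)).
Proof.
rewrite rowfac_unitv !rowfac0; case: ifP => iS; last first.
  rewrite mulr0 addr0; apply: eq_bigr => l lS; rewrite /unitv.
  by case: eqP => [e|_]; [rewrite e iS in lS|rewrite mulr0 addr0].
have D1 (F : 'I_k -> K) : \prod_(l in S) F l = F i * \prod_(l in S :\ i) F l.
  rewrite (bigD1 i) //=; congr (_ * _); apply: eq_bigl => l.
  by rewrite !inE andbC.
rewrite !D1 /unitv eqxx mulr1 mulrDl; congr (_ + _ * _); first congr (_ * _);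
by apply: eq_bigr => l; rewrite !inE => /andP[/negbTE -> _]; rewrite mulr0 addr0.
Qed.

Lemma rowfac_single (K : comNzRingType) S (z : 'I_k -> K) i a :
  rowfac S z (fun l => a * unitv K i l) = \prod_(l in S) (z l - a * unitv K i l).
Proof.
rewrite rowfacE (bigD1 i) //= {1}/unitv eqxx mulr1 [X in _ - (_ + X)]big1 ?addr0; last first.
  by move=> l li; rewrite {1}/unitv (negbTE li) mulr0 mul0r.
rewrite -mulNr -rowfac_shift rowfac0; apply: eq_bigr => l _.
by rewrite mulNr.
Qed.

(** On the diagonal, the sum of the partial derivatives over the copies becomes d/dx. *)
Lemma rowfac_const (K : comNzRingType) S (x y : K) :
  rowfac S (fun=> x) (fun=> y) = gamfac #|S| x y.
Proof.
rewrite /rowfac prodr_const /gamfac; congr (_ - _).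
rewrite -sumr_const; apply: eq_bigr => i iS; rewrite prodr_const; congr (_ * _ ^+ _).
by rewrite (cardsD1 i S) iS.
Qed.

Lemma rgam_const (K : comNzRingType) (w : family -> K) (x y : 'I_n -> K) :
  rgam w (fun j _ => x j) (fun j _ => y j) =
  gam (fun A j => #|row_of A j|) w x y.
Proof.
apply: eq_bigr => A _; congr (_ * _); apply: eq_bigr => j _.
exact: rowfac_const.
Qed.

Lemma rgam_morph (K L : comNzRingType) (f : {rmorphism K -> L}) (w : family -> K) z c :
  f (rgam w z c) = rgam (f \o w) (fun j i => f (z j i)) (fun j i => f (c j i)).
Proof.
rewrite rmorph_sum; apply: eq_bigr => A _; rewrite rmorphM; congr (_ * _).
rewrite rmorph_prod; apply: eq_bigr => j _.
rewrite rmorphB rmorph_prod rmorph_sum; congr (_ - _); apply: eq_bigr => i _.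
by rewrite rmorphM rmorph_prod.
Qed.

Lemma drgam_morph (K L : comNzRingType) (f : {rmorphism K -> L}) (w : family -> K) j i z c :
  f (drgam w j i z c) = drgam (f \o w) j i (fun j i => f (z j i)) (fun j i => f (c j i)).
Proof.
rewrite rmorphB !rgam_morph; congr (_ - _); apply: eq_rgam => // l h.
by rewrite /upd; case: eqP => // _; rewrite /unitv rmorph_nat.
Qed.

Lemma rgam_upd (K : comNzRingType) (w : family -> K) j (z c : 'I_n -> 'I_k -> K) z' c' :
  rgam w (upd z j z') (upd c j c') =
  \sum_A (w A * \prod_(l < n | l != j) rowfac (row_of A l) (z l) (c l)) *
    rowfac (row_of A j) z' c'.
Proof.
apply: eq_bigr => A _; rewrite (bigD1 j) //= /upd eqxx -mulrA [in RHS]mulrC !mulrA.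
rewrite [in RHS]mulrC mulrA mulrAC; congr (_ * _ * _).
by apply: eq_bigr => l /negbTE ->.
Qed.

Lemma upd_id2 (K : comNzRingType) (c : 'I_n -> 'I_k -> K) j v : c j =1 v -> upd c j v =2 c.
Proof. by move=> h l i; rewrite /upd; case: eqP => [->|]; rewrite ?h. Qed.

Lemma rgam_upd_row (K : comNzRingType) (w : family -> K) j (z c : 'I_n -> 'I_k -> K) v :
  c j =1 (fun=> 0) ->
  rgam w z (upd c j v) = rgam w z c - \sum_i v i * drgam w j i z c.
Proof.
move=> cj.
have e v' : rgam w z (upd c j v') = rgam w (upd z j (z j)) (upd c j v').
  by apply: eq_rgam => // l i; rewrite upd_id2.
have e0 : rgam w z c = rgam w z (upd c j (fun=> 0)).
  by apply: eq_rgam => // l i; rewrite upd_id2.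
have de i : drgam w j i z c = rgam w (upd z j (z j)) (upd c j (fun=> 0)) -
   rgam w (upd z j (z j)) (upd c j (unitv K i)) by rewrite /drgam e0 !e.
rewrite (eq_bigr _ (fun i _ => congr1 _ (de i))) e0 !e !rgam_upd.
under [X in _ - X]eq_bigr => i _ do rewrite !rgam_upd -sumrB mulr_sumr.
rewrite exchange_big -sumrB; apply: eq_bigr => A _ /=.
rewrite rowfacE mulrBr; congr (_ - _); rewrite mulr_sumr; apply: eq_bigr => i _.
by rewrite -mulrBr mulrCA.
Qed.

Lemma rgam_shift (K : comNzRingType) (w : family -> K) j i (z c : 'I_n -> 'I_k -> K) a :
  c j =1 (fun=> 0) ->
  rgam w (upd z j (fun l => z j l + a * unitv K i l)) c =
  rgam w z c + a * drgam w j i z c.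
Proof.
move=> cj; rewrite /drgam.
have e z' : rgam w z' c = rgam w z' (upd c j (fun=> 0)).
  by apply: eq_rgam => // l h; rewrite upd_id2.
have ez v : rgam w z (upd c j v) = rgam w (upd z j (z j)) (upd c j v).
  by apply: eq_rgam => // l h; rewrite upd_id2.
rewrite !e !ez !rgam_upd -sumrB mulr_sumr -big_split; apply: eq_bigr => A _ /=.
by rewrite rowfac_shift mulrDr -mulrBr mulrCA.
Qed.

Lemma rgam_single (K : comNzRingType) (w : family -> K) (z : 'I_n -> 'I_k -> K)
    (sigma : 'I_n -> 'I_k) a :
  rgam w z (fun j i => a * unitv K (sigma j) i) =
  rgam w (fun j i => z j i - a * unitv K (sigma j) i) (fun _ _ => 0).
Proof.
apply: eq_bigr => A _; congr (_ * _); apply: eq_bigr => j _.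
by rewrite rowfac_single rowfac0.
Qed.

Lemma rgam_lead (K : comNzRingType) (w : family -> K) D (c : 'I_n -> 'I_k -> K) :
  (forall A, w A != 0 -> \sum_j #|row_of A j| = D) ->
  lead_le D (rgam (polyC \o w) (fun _ _ => 'X) (fun j i => (c j i)%:P)) (\sum_A w A).
Proof.
move=> hD; apply: (big_ind2 (lead_le D)) => [||A _]; [exact: lead_le0|by move=> *; apply: lead_leD|].
have [w0|w0] := eqVneq (w A) 0; first by rewrite /= w0 polyC0 !mul0r; apply: lead_le0.
rewrite -[w A]mulr1 -[D]add0n; apply: lead_leM; first exact: lead_leC.
have -> : 1 = \prod_(j < n) 1 :> K by rewrite big1.
rewrite -(hD A w0); apply: (big_rec3 (@lead_le K)) => [|j d p e _ h]; first exact: lead_leC.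
apply: lead_leM => //.
have hX : lead_le 1 ('X : {poly K}) 1.
  by have := lead_leL (0 : K) 1; rewrite scale1r polyC0 add0r.
rewrite /rowfac -[X in lead_le _ _ X]subr0; apply: lead_leD.
  by rewrite prodr_const -[X in lead_le _ _ X](expr1n _ #|row_of A j|); apply: lead_leX.
apply: lead_leN; elim/big_ind: _ => [|p' q' hp hq|i iS]; first exact: lead_le0.
  by rewrite -[X in lead_le _ _ X]addr0; apply: lead_leD.
rewrite prodr_const (cardsD1 i (row_of A j)) iS.
rewrite -[X in lead_le _ _ X](mul0r (1 ^+ #|row_of A j :\ i|)); apply: lead_leM.
  by have := lead_leL (c j i) 0; rewrite scale0r addr0.
exact: lead_leX.
Qed.

Lemma lead_le_size (K : comNzRingType) D (p : {poly K}) : lead_le D p 0 -> (size p <= D)%N.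
Proof.
case=> sp cp; apply/leq_sizeP => i; rewrite leq_eqVlt => /predU1P[<-//|h].
by move/leq_sizeP: sp; apply.
Qed.

Lemma drgam_size (K : comNzRingType) (w : family -> K) D j i (c : 'I_n -> 'I_k -> K) :
  (forall A, w A != 0 -> \sum_j #|row_of A j| = D) ->
  (size (drgam (polyC \o w) j i (fun _ _ => 'X) (fun j i => (c j i)%:P)) <= D)%N.
Proof.
move=> hD; apply: lead_le_size; rewrite /drgam -(subrr (\sum_A w A)).
apply: lead_leD; first exact: rgam_lead.
apply: lead_leN.
rewrite (@eq_rgam _ _ (polyC \o w) _ (fun _ _ => 'X) _
  (fun l h => (upd c j (unitv K i) l h)%:P)) //; first exact: rgam_lead.
by move=> l h; rewrite /upd; case: eqP => // _; rewrite /unitv polyC_natr.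
Qed.

Section Stable.
Variables (R : rcfType) (w : family -> R).
Local Notation C := (complex R).
Local Notation toC := (real_complex R).
Local Notation Im := (@complex.Im R).
Hypothesis stable : forall z : 'I_n -> 'I_k -> C, (forall j i, 0 < Im (z j i)) ->
  rgam (toC \o w) z (fun _ _ => 0) != 0.

(** The polynomial f is affine in z_(j,i) with slope d, so it vanishes when z_(j,i) moves by - f /
    d. If Im (f / d) <= 0, this move stays in the upper half plane, against stability. *)
Lemma stable_drgam z (c : 'I_n -> 'I_k -> C) j i : c j =1 (fun=> 0) ->
  (forall z, (forall j i, 0 < Im (z j i)) -> rgam (toC \o w) z c != 0) ->
  (forall j i, 0 < Im (z j i)) ->
  drgam (toC \o w) j i z c = 0 \/
  Im (drgam (toC \o w) j i z c / rgam (toC \o w) z c) < 0.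
Proof.
move=> cj hst hz; have [->|d0] := eqVneq (drgam (toC \o w) j i z c) 0; first by left.
right; set d := drgam _ _ _ _ _ in d0 *; set f := rgam _ _ _.
have f0 : f != 0 by apply: hst.
have : 0 < Im (f / d).
  rewrite ltNge; apply/negP => h.
  have := hst (upd z j (fun l => z j l + (- (f / d)) * unitv _ i l)).
  rewrite rgam_shift // -/d -/f mulNr divfK // subrr eqxx => hh.
  suff : false by [].
  apply: hh => l h'; rewrite /upd; case: (l =P j) => // _.
  rewrite cImD /unitv; case: (h' =P i) => _ /=; rewrite ?mulr1 ?mulr0 ?addr0 //.
  by rewrite cImN ltr_wpDr // oppr_ge0.
by move/cIm_inv_lt0; rewrite invf_div.
Qed.

(** Rows are added one at a time. A zero would give sum_i c_i d_i f / f = 1; the imaginary parts are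
    nonpositive, so all vanish, and by [stable_drgam] every term is 0, which is absurd. *)
Lemma rgam_stable (c : 'I_n -> 'I_k -> R) : (forall j i, 0 <= c j i) ->
  forall z, (forall j i, 0 < Im (z j i)) ->
  rgam (toC \o w) z (fun j i => (c j i)%:C%C) != 0.
Proof.
have main (s : seq 'I_n) (c' : 'I_n -> 'I_k -> R) : (forall j i, 0 <= c' j i) ->
    (forall j i, j \notin s -> c' j i = 0) ->
    forall z, (forall j i, 0 < Im (z j i)) ->
    rgam (toC \o w) z (fun j i => (c' j i)%:C%C) != 0.
  elim: s c' => [|j s IH] c' c0 cs z hz.
    rewrite (eq_rgam (w' := toC \o w) (z' := z) (c' := fun _ _ => 0)) ?stable //.
    by move=> j i; rewrite cs.
  pose c1 := upd c' j (fun=> 0).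
  pose cc1 : 'I_n -> 'I_k -> C := fun l i => (c1 l i)%:C%C.
  have c1j : cc1 j =1 (fun=> 0).
    by move=> i; rewrite /cc1 /c1 /upd eqxx.
  have hst : forall z, (forall j i, 0 < Im (z j i)) ->
      rgam (toC \o w) z cc1 != 0.
    apply: IH => l i; rewrite /c1 /upd; case: (l =P j) => // /eqP lj ls.
    by apply: cs; rewrite inE negb_or lj.
  have -> : rgam (toC \o w) z (fun j i => (c' j i)%:C%C) =
      rgam (toC \o w) z (upd cc1 j (fun i => (c' j i)%:C%C)).
    apply: eq_rgam => // l i; rewrite /upd /cc1 /c1 /upd.
    by case: (l =P j) => [->|].
  rewrite rgam_upd_row // subr_eq0; apply/negP => /eqP e.
  set f := rgam _ _ _ in e; have f0 : f != 0 by apply: hst.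
  have e1 : \sum_i (c' j i)%:C%C * (drgam (toC \o w) j i z cc1 / f) = 1.
    rewrite -(divff f0) {2}e mulr_suml; apply: eq_bigr => i _; by rewrite mulrA.
  have Imc (a : R) (x : C) : Im (a%:C%C * x) = a * Im x.
    by rewrite cImM /= mul0r addr0.
  have dle i : Im (drgam (toC \o w) j i z cc1 / f) <= 0.
    have [->|/ltW//] := stable_drgam i c1j hst hz.
    by rewrite mul0r.
  have : \sum_i - (c' j i * Im (drgam (toC \o w) j i z cc1 / f)) = 0.
    rewrite sumrN; under eq_bigr do rewrite -Imc.
    by rewrite -cIm_sum e1 /= oppr0.
  move/psumr_eq0P => h.
  have {}h i : c' j i * Im (drgam (toC \o w) j i z cc1 / f) = 0.
    apply/eqP; rewrite -oppr_eq0; apply/eqP; apply: h => // l _.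
    by rewrite oppr_ge0 mulr_ge0_le0.
  move: e1; rewrite big1 => [/eqP|i _]; first by rewrite eq_sym oner_eq0.
  have /eqP := h i; rewrite mulf_eq0 => /orP[/eqP->|/eqP I0]; first by rewrite mul0r.
  have [->|] := stable_drgam i c1j hst hz; first by rewrite mul0r mulr0.
  by rewrite -/f I0 ltxx.
move=> c0; apply: (main (enum 'I_n)) => // j i; by rewrite mem_enum.
Qed.

End Stable.
End Rows.

(** * Choosing one derivative out of k *)

Section Choice.
Variable R : rcfType.

Lemma seq_max (s : seq R) (a : R) : a \in s ->
  exists2 m, m \in s & forall b, b \in s -> b <= m.
Proof.
elim: s a => // c s IH a _; case: s IH => [|d s] IH.
  by exists c; rewrite ?mem_head // => b; rewrite inE => /eqP ->.
have [m ms hm] := IH d (mem_head _ _); have [cm|mc] := leP c m.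
  exists m; first by rewrite inE ms orbT.
  by move=> b; rewrite inE => /predU1P[->//|]; apply: hm.
exists c; first exact: mem_head.
move=> b; rewrite inE => /predU1P[->//|/hm bm]; exact: le_trans bm (ltW mc).
Qed.

(* The functions r_i / q are decreasing to the right of the roots of q, so that the
   index with the smallest r_i / q can be chosen uniformly in x. *)
Lemma nevanlinna_choice (k : nat) (del : R) (q : {poly R}) (r : 'I_k -> {poly R}) :
  (0 < k)%N -> 0 < lead_coef q -> (forall i, (size (r i) < size q)%N) ->
  (forall i, nevanlinna q (r i)) ->
  (forall x, del < x -> 0 < (q - \sum_i r i).[x]) ->
  exists i, forall x, del < x -> 0 < (q - k%:R *: r i).[x].
Proof.
move=> k0 lq sz nev hpos.
have [rs qs] : exists rs : seq R, q = lead_coef q *: \prod_(a <- rs) ('X - a%:P).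
  by apply: real_rooted_split => s /(nev (Ordinal k0))[].
have rootE a : root q a = (a \in rs) by rewrite qs rootZ ?gt_eqF // root_prod_XsubC.
have qbig x : (forall a, a \in rs -> a < x) -> 0 < q.[x].
  move=> h; rewrite qs hornerZ pmulr_rgt0 // horner_prod big_seq.
  by apply: prodr_gt0 => a /h; rewrite hornerXsubC subr_gt0.
have decomp i := nevanlinna_decomp (sz i) (nev i).
(* At the largest root of [q] all [r i] are nonnegative, as limits from the right, so q - sum_i r_i
   is not positive there. Hence no root exceeds [del]. *)
have qpos x : del < x -> 0 < q.[x].
  move=> dx; rewrite ltNge; apply/negP => qx.
  have [a ars xa] : exists2 a, a \in rs & x <= a.
    apply/hasP; apply: contraT => /hasPn h; move: qx; rewrite leNgt.
    by rewrite qbig // => a /h; rewrite -ltNge.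
  have [m mrs hm] := seq_max ars.
  have rm i : 0 <= (r i).[m].
    have -> : (r i).[m] = (r i \Po ('X + m%:P)).[0].
      by rewrite horner_comp !hornerE.
    apply: (@poly_ge0_near0 _ _ 1) => // h /andP[h0 _].
    rewrite horner_comp !hornerE; set y := h + m.
    have my : m < y by rewrite ltrDr.
    have qy : 0 < q.[y] by apply: qbig => b /hm bm; apply: le_lt_trans my.
    have [L [hL eL]] := decomp i.
    rewrite -(pmulr_lge0 _ (_ : 0 < q.[y]^-1)) ?invr_gt0 //.
    rewrite (nevanlinna_evalR hL eL) ?gt_eqF // big_seq; apply: sumr_ge0 => p /hL[p0].
    rewrite rootE => /hm pm; rewrite divr_ge0 // subr_ge0.
    exact: le_trans pm (ltW my).
  have dm : del < m by apply: lt_le_trans dx (le_trans xa _); apply: hm.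
  have := hpos m dm; rewrite hornerD hornerN horner_sum.
  have /rootP -> : root q m by rewrite rootE.
  by rewrite add0r oppr_gt0 ltNge sumr_ge0.
have rle a : a \in rs -> a <= del.
  move=> ars; rewrite leNgt; apply/negP => /qpos.
  by have /rootP -> : root q a by [rewrite rootE]; rewrite ltxx.
have dec i x y : del < x -> x <= y -> (r i).[y] / q.[y] <= (r i).[x] / q.[x].
  move=> dx xy; have dy := lt_le_trans dx xy.
  have [L [hL eL]] := decomp i.
  rewrite !(nevanlinna_evalR hL eL) ?gt_eqF ?qpos //.
  rewrite !big_seq; apply: ler_sum => p /hL[p0]; rewrite rootE => /rle pd.
  have px : 0 < x - p.2 by rewrite subr_gt0; apply: le_lt_trans dx.
  have py : 0 < y - p.2 by rewrite subr_gt0; apply: le_lt_trans dy.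
  by rewrite ler_wpM2l // lef_pV2 ?posrE // lerD2r.
apply: contrapT => hN.
have /fin_all_exists[x hx] i : exists x, del < x /\ (q - k%:R *: r i).[x] <= 0.
  apply: contrapT => hn; apply: hN; exists i => x dx.
  rewrite ltNge; apply/negP => le0; apply: hn; by exists x.
(* If each i fails at some x_i, then by monotonicity all of them fail at the least x_i: every r_i /
   q is at least 1 / k there, and the sum is at least 1. *)
pose y := \big[Num.min/(del + 1)]_i x i.
have dy : del < y.
  apply/bigmin_gtP; split; first by rewrite ltrDl.
  by move=> i _; case: (hx i).
have yx i : y <= x i by apply: bigmin_le.
have kk : 0 < k%:R :> R by rewrite ltr0n.
have hk i : k%:R^-1 <= (r i).[y] / q.[y].
  have [dx] := hx i; rewrite hornerD hornerN hornerZ subr_le0 => h.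
  apply: le_trans (dec i _ _ dy (yx i)).
  by rewrite ler_pdivlMr ?qpos // mulrC ler_pdivrMr // mulrC.
have := hpos y dy; rewrite hornerD hornerN horner_sum subr_gt0 ltNge => /negP; apply.
have -> : \sum_i (r i).[y] = q.[y] * \sum_i (r i).[y] / q.[y].
  rewrite mulr_sumr; apply: eq_bigr => i _; rewrite mulrC divfK // gt_eqF //.
  exact: qpos.
rewrite ler_peMr ?(ltW (qpos _ dy)) //.
apply: le_trans (ler_sum _ (fun i _ => hk i)).
by rewrite sumr_const card_ord -(mulr_natr k%:R^-1) mulVf // gt_eqF.
Qed.

End Choice.

(** * Products of copies of the partition function *)

Section PartitionFunction.
Variables (n k : nat).

(** P_mu over an arbitrary ring, to be used over the reals, the complex numbers and polynomials. *)
Definition pf (K : comNzRingType) (m : {set 'I_n} -> K) (x : 'I_n -> K) : K :=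
  \sum_S m S * \prod_(j in S) x j.

Definition pow_weight (K : comNzRingType) (m : {set 'I_n} -> K)
  (A : {ffun 'I_k -> {set 'I_n}}) : K := \prod_i m (A i).

Lemma rgam_pf (K : comNzRingType) (m : {set 'I_n} -> K) (z : 'I_n -> 'I_k -> K) :
  rgam (pow_weight m) z (fun _ _ => 0) = \prod_i pf m (fun j => z j i).
Proof.
rewrite /pf bigA_distr_bigA /=; apply: eq_bigr => A _.
rewrite big_split /=; congr (_ * _).
under eq_bigr do rewrite rowfac0.
rewrite (exchange_big_dep xpredT) //=; apply: eq_bigr => i _.
by apply: eq_bigl => j; rewrite inE.
Qed.

Lemma pow_weight_morph (K L : comNzRingType) (f : {rmorphism K -> L}) m A :
  f (pow_weight m A) = pow_weight (f \o m) A.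
Proof. by rewrite rmorph_prod. Qed.

Lemma sum_row_of (A : {ffun 'I_k -> {set 'I_n}}) :
  (\sum_j #|row_of A j| = \sum_i #|A i|)%N.
Proof.
under eq_bigr do rewrite -sum1_card.
under [RHS]eq_bigr do rewrite -sum1_card.
rewrite (exchange_big_dep xpredT) //=; apply: eq_bigr => i _.
by apply: eq_bigl => j; rewrite inE.
Qed.

End PartitionFunction.

(** * Application to strong Rayleigh measures *)

Section StrongRayleigh.
Variables (R : realType) (n k d : nat) (eps : R) (mu : {ffun {set 'I_n} -> R}).
Local Notation C := (complex R).
Local Notation toC := (real_complex R).
Local Notation Im := (@complex.Im R).
Hypothesis k2 : (2 <= k)%N.
Hypothesis prob : prob_measure mu.
Hypothesis rayleigh : strong_Rayleigh mu.
Hypothesis csum : constant_sum mu d.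
Hypothesis marginal : forall i : 'I_n, \sum_(S : {set 'I_n} | i \in S) mu S <= eps.

Local Notation w := (@pow_weight n k R mu).
Local Notation bound := (delta (k%:R * eps) n).

Lemma pf_gt0 (x : 'I_n -> R) : (forall j, 0 < x j) -> 0 < pf mu x.
Proof.
move=> hx; have [mu0 mu1] := prob.
have ge0 S : 0 <= mu S * \prod_(j in S) x j.
  by rewrite mulr_ge0 // prodr_ge0 // => j _; rewrite ltW.
rewrite lt_neqAle sumr_ge0 // andbT; apply/eqP => e.
have /psumr_eq0P h : \sum_S mu S * \prod_(j in S) x j = 0 by exact: esym e.
have z S : mu S = 0.
  have /eqP := h (fun S _ => ge0 S) S isT; rewrite mulf_eq0 => /orP[/eqP//|].
  by rewrite gt_eqF // prodr_gt0.
by move: mu1; rewrite big1 // => /eqP; rewrite eq_sym oner_eq0.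
Qed.

Lemma pf1 : pf mu (fun=> 1) = 1.
Proof.
have [_ mu1] := prob; rewrite -[RHS]mu1; apply: eq_bigr => S _.
by rewrite big1 ?mulr1.
Qed.

Lemma pow_weight_stable (z : 'I_n -> 'I_k -> C) : (forall j i, 0 < Im (z j i)) ->
  rgam (toC \o w) z (fun _ _ => 0) != 0.
Proof.
move=> hz; rewrite (eq_rgam (w' := pow_weight (toC \o mu)) (z' := z) (c' := fun _ _ => 0)) //.
  rewrite rgam_pf; apply/prodf_neq0 => i _.
  by apply: (rayleigh (x := fun j => z j i)) => j.
by move=> A /=; rewrite pow_weight_morph.
Qed.

Lemma pow_weight_homog (A : {ffun 'I_k -> {set 'I_n}}) : w A != 0 ->
  (\sum_j #|row_of A j| = k * d)%N.
Proof.
move=> wA; rewrite sum_row_of (eq_bigr (fun=> d)) ?sum_nat_const ?card_ord // => i _.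
apply: csum; apply: contraNneq wA => e.
by rewrite /pow_weight (bigD1 i) //= e mul0r.
Qed.

Lemma sum_pow_weight : \sum_A w A = 1.
Proof.
have <- : rgam w (fun _ _ => 1) (fun _ _ => 0) = 1.
  by rewrite rgam_pf big1 // => i _; apply: pf1.
apply: eq_bigr => A _; rewrite big1 ?mulr1 // => j _.
by rewrite rowfac0 big1.
Qed.

Lemma trace_pow_weight j :
  dgam (fun A j => #|row_of A j|) w j (fun=> 1) (fun=> 0) =
  k%:R * \sum_(S : {set 'I_n} | j \in S) mu S.
Proof.
set p := \sum_(S | _) _; pose t (A : {ffun 'I_k -> {set 'I_n}}) j := #|row_of A j|.
pose P := gam t (polyC \o w) (line (fun=> 1) (fun l => (l == j)%:R)) (polyC \o (fun=> 0)).
have -> : dgam t w j (fun=> 1) (fun=> 0) = P^`().[0].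
  rewrite deriv_gam // -[RHS]/(horner_eval 0 _) dgam_morph; apply: eq_dgam => l /=;
    by rewrite /horner_eval ?hornerC // /line !hornerE.
have -> : P = (1 + p *: 'X) ^+ k.
  rewrite /P -rgam_const.
  rewrite (eq_rgam (w' := pow_weight (polyC \o mu))
    (z' := fun l _ => line (fun=> 1) (fun l => (l == j)%:R) l)
    (c' := fun _ _ => 0)) //; last first.
    by move=> A /=; rewrite pow_weight_morph.
  rewrite rgam_pf prodr_const card_ord; congr (_ ^+ _).
  have one : 1 = \sum_S (mu S)%:P :> {poly R} by rewrite -rmorph_sum (proj2 prob).
  rewrite /p [X in _ = X + _]one scaler_suml [X in _ = _ + X]big_mkcond -[RHS]big_split /=.
  apply: eq_bigr => S _ /=; case: ifP => jS.
    rewrite (bigD1 j) //= /line eqxx scale1r big1 => [|l /andP[_ /negbTE ->]].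
      by rewrite mulr1 mulrDr mulr1 mul_polyC.
    by rewrite scale0r addr0.
  rewrite addr0 big1 ?mulr1 // => l lS; rewrite /line.
  case: eqP => [e|_]; last by rewrite scale0r addr0.
  by rewrite e jS in lS.
rewrite deriv_exp derivD derivC derivZ derivX add0r.
by rewrite hornerMn hornerM horner_exp !hornerE expr1n mulr1 mulr_natl.
Qed.

(** The marginals sum to d, so n eps >= d >= 1, and k >= 2 makes the inequality strict. *)
Lemma marginal_gt : (0 < d)%N -> (0 < n)%N /\ n%:R^-1 < k%:R * eps.
Proof.
move=> d0; have [mu0 mu1] := prob.
have sumd : \sum_(i < n) \sum_(S : {set 'I_n} | i \in S) mu S = d%:R.
  rewrite (exchange_big_dep xpredT) //= -[RHS]mulr1 -[X in _ * X]mu1 mulr_sumr.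
  apply: eq_bigr => S _; rewrite sumr_const.
  have [->|/csum ->] := eqVneq (mu S) 0; first by rewrite mul0rn mulr0.
  by rewrite mulr_natl.
have hd : d%:R <= n%:R * eps.
  rewrite -sumd; apply: le_trans (ler_sum _ (fun i _ => marginal i)) _.
  by rewrite sumr_const card_ord mulr_natl.
have d1 : 1 <= d%:R :> R by rewrite ler1n.
have n0 : (0 < n)%N.
  rewrite lt0n; apply/eqP => n0; move: hd; rewrite n0 mul0r; lra.
have N0 : 0 < n%:R :> R by rewrite ltr0n.
split=> //; rewrite -(ltr_pM2l N0) mulfV ?gt_eqF // mulrCA.
apply: (@lt_le_trans _ _ 2); first by lra.
apply: (@le_trans _ _ (k%:R * 1)); first by rewrite mulr1 ler_nat.
by rewrite ler_pM2l ?ltr0n ?(leq_trans _ k2) //; lra.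
Qed.

Lemma rgam1_gt0 (T : R) : (0 < d)%N -> bound < T ->
  0 < rgam w (fun _ _ => T) (fun _ _ => 1).
Proof.
move=> d0 hT; have [n0 hn] := marginal_gt d0.
rewrite (rgam_const w (fun=> T) (fun=> 1)).
apply: (mixed_bound (D := (k * d)%N) (alpha := k%:R * eps)) => //.
- exact: pow_weight_homog.
- move=> x hx; rewrite -(rgam_const (toC \o w) x (fun=> 0)).
  exact: pow_weight_stable.
- move=> x hx; rewrite -(rgam_const w x (fun=> 0)) rgam_pf.
  by apply: prodr_gt0 => i _; apply: pf_gt0.
move=> j; rewrite trace_pow_weight -(rgam_const w (fun=> 1) (fun=> 0)) rgam_pf.
by rewrite [X in _ <= _ * X]big1 ?mulr1 ?ler_pM2l ?ltr0n ?(leq_trans _ k2) // => i _; apply: pf1.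
Qed.

(** One assignment. Stability survives the rows already treated by [rgam_stable], and the leading
    coefficient of [q] is the total mass 1, so [nevanlinna_choice] applies. *)
Lemma rgam_choice (c : 'I_n -> 'I_k -> R) (j : 'I_n) (B : R) :
  (forall l i, 0 <= c l i) -> c j =1 (fun=> 0) ->
  (forall x, B < x -> 0 < rgam w (fun _ _ => x) (upd c j (fun=> 1))) ->
  exists i, forall x, B < x ->
    0 < rgam w (fun _ _ => x) (upd c j (fun l => k%:R * unitv R i l)).
Proof.
move=> c0 cj hpos.
pose q := rgam (polyC \o w) (fun _ _ => 'X) (fun l i => (c l i)%:P).
pose r i := drgam (polyC \o w) j i (fun _ _ => 'X) (fun l i => (c l i)%:P).
have qE x : q.[x] = rgam w (fun _ _ => x) c.
  rewrite -[LHS]/(horner_eval x _) rgam_morph; apply: eq_rgam => [?|? ?|? ?];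
    by rewrite /= /horner_eval ?hornerX ?hornerC.
have rE i x : (r i).[x] = drgam w j i (fun _ _ => x) c.
  rewrite -[LHS]/(horner_eval x _) drgam_morph; apply: eq_drgam => [?|? ?|? ?];
    by rewrite /= /horner_eval ?hornerX ?hornerC.
have [szq cq] := rgam_lead (D := (k * d)%N) c pow_weight_homog.
rewrite sum_pow_weight -/q in szq cq.
have sz : size q = (k * d).+1.
  apply/eqP; rewrite eqn_leq szq ltnNge; apply/negP => /leq_sizeP/(_ _ (leqnn _)).
  by rewrite cq => /eqP; rewrite oner_eq0.
have mE (P : {poly R}) (z : C) : (map_poly toC P).[z] =
   (horner_eval z \o map_poly toC) P by [].
have updE x v : rgam w (fun _ _ => x) (upd c j v) = q.[x] - \sum_i v i * (r i).[x].
  by rewrite rgam_upd_row // qE; congr (_ - _); apply: eq_bigr => i _; rewrite rE.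
have [||i|i s s0|x dx|i hi] := @nevanlinna_choice R k B q r.
- by rewrite (leq_trans _ k2).
- by rewrite lead_coefE sz cq.
- by rewrite sz ltnS; apply: drgam_size; apply: pow_weight_homog.
- have hst : forall z, (forall j i, 0 < Im (z j i)) ->
      rgam (toC \o w) z (fun l i => (c l i)%:C%C) != 0.
    by apply: rgam_stable => //; apply: pow_weight_stable.
  have qC : (map_poly toC q).[s] = rgam (toC \o w) (fun _ _ => s) (fun l i => (c l i)%:C%C).
    rewrite mE rgam_morph; apply: eq_rgam => [?|? ?|? ?] /=;
      by rewrite /horner_eval ?map_polyC ?map_polyX ?hornerX ?hornerC.
  have rC : (map_poly toC (r i)).[s] = drgam (toC \o w) j i (fun _ _ => s) (fun l i => (c l i)%:C%C).
    rewrite mE drgam_morph; apply: eq_drgam => [?|? ?|? ?] /=;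
      by rewrite /horner_eval ?map_polyC ?map_polyX ?hornerX ?hornerC.
  rewrite qC rC; split; first exact: hst.
  have cj' : (fun l i => (c l i)%:C%C) j =1 (fun=> 0 : C) by move=> l; rewrite cj.
  have [->|/ltW//] := stable_drgam i cj' hst (fun _ _ => s0).
  by rewrite mul0r.
- rewrite hornerD hornerN [(\sum_i r i).[x]]horner_sum; have := hpos x dx; rewrite updE.
  by rewrite (eq_bigr (fun i => (r i).[x])) // => i _; rewrite mul1r.
exists i => x dx; rewrite updE (bigD1 i) //= big1 ?addr0.
  by have := hi x dx; rewrite hornerD hornerN hornerZ /unitv eqxx mulr1.
by move=> l /negbTE li; rewrite /unitv li mulr0 mul0r.
Qed.

Lemma exists_assignment : (0 < d)%N -> exists sigma : 'I_n -> 'I_k,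
  forall x, bound < x -> 0 < \prod_i pf mu (fun j => x - k%:R * (sigma j == i)%:R).
Proof.
move=> d0.
(* Assigned elements carry the operator 1 - k d_(sigma j, j), the others still carry 1 - sum_i
   d_(i,j). *)
pose c (s : seq 'I_n) (sigma : 'I_n -> 'I_k) j : 'I_k -> R :=
  if j \in s then fun l => k%:R * unitv R (sigma j) l else fun=> 1.
have main s : uniq s -> exists sigma, forall x, bound < x ->
    0 < rgam w (fun _ _ => x) (c s sigma).
  elim: s => [_|j s IH /= /andP[js us]].
    by exists (fun=> Ordinal (leq_trans (isT : 0 < 2)%N k2)) => x; apply: rgam1_gt0.
  have [sigma hs] := IH us.
  have [|||i hi] := @rgam_choice (upd (c s sigma) j (fun=> 0)) j bound.
  - move=> l i; rewrite /upd; case: eqP => // _; rewrite /c; case: ifP => // _.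
    by rewrite mulr_ge0.
  - by move=> l; rewrite /upd eqxx.
  - move=> x /hs; congr (0 < _); apply: eq_rgam => // l i; rewrite /upd.
    by case: eqP => // ->; rewrite /c (negbTE js).
  exists (upd sigma j i) => x /hi; congr (0 < _); apply: eq_rgam => // l h.
  rewrite /upd /c inE; by case: (l =P j) => [->|lj] //=; case: ifP.
have [sigma hs] := main _ (enum_uniq 'I_n); exists sigma => x /hs.
have -> : rgam w (fun _ _ => x) (c (enum 'I_n) sigma) =
    rgam w (fun _ _ => x) (fun j i => k%:R * unitv R (sigma j) i).
  by apply: eq_rgam => // j i; rewrite /c mem_enum.
rewrite rgam_single rgam_pf; congr (0 < _); apply: eq_bigr => i _.
by apply: eq_bigr => S _; congr (_ * _); apply: eq_bigr => j _; rewrite /unitv eq_sym.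
Qed.

Lemma hyp_poly_eval (x : 'I_n -> R) s : (hyp_poly mu x).[s] = pf mu (fun j => s - x j).
Proof.
rewrite horner_sum; apply: eq_bigr => S _; rewrite hornerM hornerC horner_prod.
by congr (_ * _); apply: eq_bigr => j _; rewrite hornerXsubC.
Qed.

Lemma hyp_poly_split (x : 'I_n -> R) : exists rs : seq R,
  size (hyp_poly mu x) = d.+1 /\ hyp_poly mu x = \prod_(a <- rs) ('X - a%:P).
Proof.
have [sz cf] : lead_le d (hyp_poly mu x) 1.
  have [_ mu1] := prob; rewrite -mu1.
  apply: (big_ind2 (lead_le d)) => [||S _]; [exact: lead_le0|by move=> *; apply: lead_leD|].
  have [->|/csum <-] := eqVneq (mu S) 0; first by rewrite polyC0 mul0r; apply: lead_le0.
  rewrite -[X in lead_le _ _ X]mulr1 -[#|S|]add0n; apply: lead_leM; first exact: lead_leC.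
  rewrite -sum1_card; have -> : 1 = \prod_(j in S) 1 :> R by rewrite big1.
  apply: (big_rec3 (@lead_le R)) => [|j e p a _ h]; first exact: lead_leC.
  apply: lead_leM => //; rewrite addrC -polyCN -['X]scale1r; exact: lead_leL.
have sq : size (hyp_poly mu x) = d.+1.
  apply/eqP; rewrite eqn_leq sz ltnNge; apply/negP => /leq_sizeP/(_ _ (leqnn _)).
  by rewrite cf => /eqP; rewrite oner_eq0.
have [|rs e] := @real_rooted_split R (hyp_poly mu x).
  move=> s s0; rewrite rmorph_sum horner_sum.
  have := @rayleigh (fun j => s - (x j)%:C%C); rewrite /partition_fun => h.
  have {}h : forall j, 0 < Im (s - (x j)%:C%C) by move=> j; rewrite cImD cImN /= subr0.
  have := rayleigh h; congr (_ != 0); apply: eq_bigr => S _.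
  rewrite rmorphM /= map_polyC hornerM hornerC rmorph_prod horner_prod.
  congr (_ * _); apply: eq_bigr => j _.
  by rewrite rmorphB /= map_polyX map_polyC hornerXsubC.
by exists rs; split=> //; rewrite {1}e lead_coefE sq cf scale1r.
Qed.

Lemma hnorm_sorted (lam : seq R) : sorted (fun a b => b <= a) lam ->
  (forall a, a \in lam -> 0 <= a) -> hnorm_of lam = lambda_max_of lam.
Proof.
rewrite /hnorm_of /lambda_max_of; elim: lam => [|a lam IH] /= hs h0; first by rewrite big_nil.
rewrite big_cons IH; last first.
- by move=> b bl; apply: h0; rewrite inE bl orbT.
- exact: path_sorted hs.
rewrite ger0_norm; last by apply: h0; exact: mem_head.
apply/max_idPl; case: lam hs {IH} h0 => [_|b lam /andP[ba _] _] //=.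
by apply; exact: mem_head.
Qed.

Lemma partition_eigenvalues (S : {set 'I_n}) :
  (forall a, root (hyp_poly mu (e_set R S)) a -> k%:R * a <= bound) ->
  exists lam : seq R, eigenvalues mu (e_set R S) lam /\
    hnorm_of lam = lambda_max_of lam /\ lambda_max_of lam <= k%:R^-1 * bound.
Proof.
move=> hb; have [rs [_ e]] := hyp_poly_split (e_set R S).
pose lam := sort (fun a b : R => b <= a) rs.
have lamP : perm_eq lam rs by rewrite perm_sort.
have srt : sorted (fun a b => b <= a) lam.
  by apply: sort_sorted => a b; apply: le_total.
have rootE a : root (hyp_poly mu (e_set R S)) a = (a \in lam).
  by rewrite e root_prod_XsubC (perm_mem lamP).
have lam0 a : a \in lam -> 0 <= a.
  rewrite -rootE => /rootP ra; rewrite leNgt; apply/negP => a0.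
  (* For a < 0 this point is strictly positive, so P_mu cannot vanish there; by homogeneity [a] is
     not an eigenvalue. Nonnegative eigenvalues make the norm equal to the largest one. *)
  pose y j : R := - a + e_set R S j.
  have : 0 < pf mu y.
    by apply: pf_gt0 => j; rewrite ltr_wpDr ?oppr_gt0 // /e_set ler0n.
  suff -> : pf mu y = (-1) ^+ d * (hyp_poly mu (e_set R S)).[a].
    by rewrite ra mulr0 ltxx.
  rewrite hyp_poly_eval mulr_sumr; apply: eq_bigr => T _.
  have [->|/csum <-] := eqVneq (mu T) 0; first by rewrite !mul0r mulr0.
  rewrite mulrCA; congr (_ * _); rewrite -prodr_const -big_split; apply: eq_bigr => j _ /=.
  by rewrite /y mulN1r opprB addrC.
have k0 : 0 < k%:R :> R by rewrite ltr0n (leq_trans _ k2).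
exists lam; split; last split; last 1 first.
(* Without eigenvalues the default 0 is below the bound, which is a square divided by k. *)
- rewrite /lambda_max_of; case: (lam) hb rootE => [|a l] hb rE /=.
    by rewrite mulr_ge0 ?invr_ge0 ?(ltW k0) // /delta sqr_ge0.
  by rewrite ler_pdivlMl // hb // rE mem_head.
- split=> //; rewrite -[Preal mu _]/(pf mu (fun=> 1)) pf1 scale1r e.
  by apply: perm_big; rewrite perm_sym.
- exact: hnorm_sorted.
Qed.

Lemma exists_bounded_assignment : exists sigma : 'I_n -> 'I_k, forall i a,
  root (hyp_poly mu (e_set R [set j | sigma j == i])) a -> k%:R * a <= bound.
Proof.
have k0 : 0 < k%:R :> R by rewrite ltr0n (leq_trans _ k2).
(* For d = 0 the polynomial is a nonzero constant without roots, and any assignment will do. *)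
have [d0|d0] := posnP d.
  exists (fun=> Ordinal (leq_trans (isT : 0 < 2)%N k2)) => i a.
  have [rs [sz _]] := hyp_poly_split (e_set R [set j | Ordinal (leq_trans (isT : 0 < 2)%N k2) == i]).
  have /eqP/size_poly1P[c c0 ->] : size (hyp_poly mu (e_set R [set j : 'I_n |
    Ordinal (leq_trans (isT : 0 < 2)%N k2) == i])) = 1%N by rewrite sz d0.
  by rewrite rootC (negbTE c0).
have [sigma hs] := exists_assignment d0; exists sigma => i a /rootP ra.
rewrite leNgt; apply/negP => /hs; rewrite (bigD1 i) //=.
suff -> : pf mu (fun j => k%:R * a - k%:R * (sigma j == i)%:R) = 0 by rewrite mul0r ltxx.
(* Homogeneity turns an eigenvalue [a] into a zero of the i-th factor at x = k a, where the product
   would be positive if k a exceeded the bound. *)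
transitivity (k%:R ^+ d * (hyp_poly mu (e_set R [set j | sigma j == i])).[a]).
  rewrite hyp_poly_eval mulr_sumr; apply: eq_bigr => T _.
  have [->|/csum <-] := eqVneq (mu T) 0; first by rewrite !mul0r mulr0.
  rewrite mulrCA; congr (_ * _); rewrite -prodr_const -big_split; apply: eq_bigr => j _ /=.
  by rewrite /e_set inE mulrBr.
by rewrite ra mulr0.
Qed.

End StrongRayleigh.

Unset Implicit Arguments.

Theorem theorem8p1 (R : realType) (n k d : nat) (eps : R)
  (mu : {ffun {set 'I_n} -> R}) :
  (2 <= k)%N -> 0 < eps ->
  prob_measure mu -> strong_Rayleigh mu -> constant_sum mu d ->
  (forall i : 'I_n, \sum_(S : {set 'I_n} | i \in S) mu S <= eps) ->
  exists S : 'I_k -> {set 'I_n},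
    (forall i j, i != j -> [disjoint S i & S j]) /\
    \bigcup_(i < k) S i = [set: 'I_n] /\
    forall i, exists lam : seq R,
      eigenvalues mu (e_set R (S i)) lam /\
      hnorm_of lam = lambda_max_of lam /\
      lambda_max_of lam <= k%:R^-1 * delta (k%:R * eps) n.
Proof.
move=> k2 _ prob rayleigh csum marginal.
have [sigma hs] := exists_bounded_assignment k2 prob rayleigh csum marginal.
exists (fun i => [set j | sigma j == i]); split; [|split].
- move=> i j ij; rewrite -setI_eq0; apply/eqP/setP => l; rewrite !inE.
  by case: eqP => // ->; apply: negbTE.
- by apply/setP => l; rewrite !inE; apply/bigcupP; exists (sigma l); rewrite // inE.
move=> i; apply: (partition_eigenvalues k2 prob rayleigh csum); exact: hs.
Qed.
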